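(* For any $k\geq 2$ and positive integers $m_1,\dots,m_k$, the numbers of equivalent embeddings of the cubic caterpillar-Halin graph $H_{m_1,\dots,m_k}$ into surfaces of Euler-genus $0$ and $1$ are $$\varepsilon_{m_1,\dots,m_k}(0)=2,\qquad \varepsilon_{m_1,\dots,m_k}(1)=8(m_1+m_2+\cdots+m_k+k)-10.$$
   Context: Counting embeddings. The Euler-genus of a closed surface is $2j$ for the orientable surface with $j$ handles and $c$ for the non-orientable surface with $c$ crosscaps. A pure rotation system of a graph $G$ assigns to every vertex a cyclic permutation of its incident edges; a general rotation system is a pure rotation system together with a map $\tau:E(G)\to\{0,1\}$ (an edge $e$ is twisted if $\tau(e)=1$, untwisted otherwise); it determines a cellular embedding of $G$ in a closed surface. For a fixed spanning tree $T$ of $G$, a $T$-rotation system is a general rotation system with $\tau(e)=0$ for all $e\in E(T)$. Embeddings with equivalent $T$-rotation systems are identified, so the number $\varepsilon_G(i)$ of equivalent embeddings of $G$ into surfaces of Euler-genus $i$ is the number of $T$-rotation systems whose embedding surface has Euler-genus $i$. The graphs $H_{m_1,\dots,m_k}$. Let $k\ge 2$, $m_1,\dots,m_k\ge 1$. Put $n_1=m_1$, $n_i=m_i+1$ for $1<i<k$, $n_k=m_k$, and $\ell=n_1+\dots+n_k$. Take the path $v_0v_1\cdots v_{\ell+1}$ drawn horizontally and attach to each $v_i$ ($1\le i\le\ell$) a leaf $u_i$; the first $n_1$ of the leaves $u_i$ are drawn above the path, the next $n_2$ below, the next $n_3$ above, and so on alternately. Add a cycle $C$ through all leaves of this tree in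 their planar order: $v_0$, then the upper leaves $u_i$ in increasing order of index, then $v_{\ell+1}$, then the lower leaves $u_i$ in decreasing order of index. The resulting cubic graph is the cubic caterpillar-Halin graph $H_{m_1,\dots,m_k}$. Write $\varepsilon_{m_1,\dots,m_k}(j)=\varepsilon_{H_{m_1,\dots,m_k}}(j)$. *)

(* Defs.v *)
From mathcomp Require Import all_boot all_order all_algebra all_fingroup.
Set Implicit Arguments.
Unset Strict Implicit.
Unset Printing Implicit Defensive.
Import Order.TTheory GRing.Theory Num.Theory.

Record sgraph := SGraph {
  vertex :> finType;
  adj : rel vertex;
  adj_sym : symmetric adj;
  adj_irrefl : irreflexive adj }.

Section Embeddings.
Variable G : sgraph.

Definition edges : {set {set G}} :=
  [set [set p.1; p.2] | p : G * G & adj p.1 p.2].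

Definition spanning_tree (T : {set {set G}}) : Prop :=
  let eT := [rel x y : G | [set x; y] \in T] in
  [/\ T \subset edges,
      forall x y, connect eT x y
    & forall c, ucycle eT c -> size c <= 2].

Definition nbrs (v : G) : {set G} := [set w | adj v w].

(* Since G is simple, the edge vw at v is encoded by the neighbour w; the     *)
(* rotation at v is the identity outside nbrs v.                              *)
Definition pure_rotation_system (rho : {ffun G -> {perm G}}) : bool :=
  [forall v, perm_on (nbrs v) (rho v) &&
             [forall w in nbrs v, porbit (rho v) w == nbrs v]].

(* The map tau : E(G) -> {0,1} is encoded by the set of twisted edges.        *)
Definition rotation_data : finType :=
  ({ffun G -> {perm G}} * {set {set G}})%type.

Definition rotation_system (R : rotation_data) : bool :=
  pure_rotation_system R.1 && (R.2 \subset edges).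

Definition T_rotation_system (T : {set {set G}}) (R : rotation_data) : bool :=
  rotation_system R && [disjoint R.2 & T].

Definition twisted (R : rotation_data) (x y : G) : bool := [set x; y] \in R.2.

(* A flag (x, y, s) is a traversal of the edge xy from x to y along one of    *)
(* its two sides: s = false means that, near x, rotations are currently read  *)
(* as given, and s = true that they are read reversed.                        *)
Definition flag : finType := (G * G * bool)%type.

Definition flags : {set flag} := [set f | adj f.1.1 f.1.2].

Definition face_step (R : rotation_data) (f : flag) : flag :=
  let: (x, y, s) := f in
  let s' := s (+) twisted R x y in
  (y, (if s' then (R.1 y)^-1%g x else R.1 y x), s').

(* The same side of the same edge, traversed in the opposite direction.       *)
Definition face_rev (R : rotation_data) (f : flag) : flag :=
  let: (x, y, s) := f in (y, x, ~~ (s (+) twisted R x y)).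

Definition face_of (R : rotation_data) (f : flag) : {set flag} :=
  [set g | fconnect (face_step R) f g
           || fconnect (face_step R) (face_rev R f) g].

Definition faces (R : rotation_data) : {set {set flag}} :=
  [set face_of R f | f in flags].

Definition euler_char (R : rotation_data) : int :=
  (#|G|%:Z - #|edges|%:Z + #|faces R|%:Z)%R.

(* The surface glued from the faces is orientable iff one can choose for each *)
(* face a direction of its boundary walk so that every edge is traversed once *)
(* in each direction; O is the set of flags traversed by the chosen walks.    *)
Definition orientable (R : rotation_data) : bool :=
  [exists O : {set flag}, [forall f in flags,
    [&& (face_step R f \in O) == (f \in O),
        (face_rev R f \in O) == (f \notin O)
      & ((f.1, ~~ f.2) \in O) == (f \notin O)]]].

End Embeddings.

Inductive closed_surface :=
  | Handles of nat
  | Crosscaps of nat.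

Definition euler_genus (S : closed_surface) : nat :=
  match S with Handles j => 2 * j | Crosscaps c => c end.

Section Counting.
Variable G : sgraph.

(* For connected G, by the classification of closed surfaces. A nonorientable *)
(* surface has at least one crosscap.                                         *)
Definition embeds_in (R : rotation_data G) (S : closed_surface) : bool :=
  match S with
  | Handles j => orientable R && (euler_char R == 2 - 2 * j%:Z)%R
  | Crosscaps c =>
      [&& ~~ orientable R, 0 < c & (euler_char R == 2 - c%:Z)%R]
  end.

Definition embeds_in_genus (i : nat) (R : rotation_data G) : bool :=
  [exists j : 'I_i.+1,
     has (fun S => (euler_genus S == i) && embeds_in R S)
         [:: Handles j; Crosscaps j]].

Lemma embeds_in_genusP i R :
  reflect (exists S, euler_genus S = i /\ embeds_in R S) (embeds_in_genus i R).
Proof.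
apply: (iffP existsP) => [[j] /=|[S [Si RS]]].
  case/or3P => // /andP[/eqP Si RS]; first by exists (Handles j).
  by exists (Crosscaps j).
have lej : (if S is Handles j then j else i) < i.+1.
  by case: S Si {RS} => //= j <-; rewrite ltnS mul2n -addnn leq_addr.
exists (Ordinal lej); rewrite [has _ _]/= orbF; apply/orP.
case: S Si RS lej => [j|c] /= Si RS lej; [left | right].
  by rewrite Si eqxx.
by rewrite eqxx; move: RS; rewrite Si.
Qed.

Definition num_embeddings (T : {set {set G}}) (i : nat) : nat :=
  #|[set R : rotation_data G | T_rotation_system T R & embeds_in_genus i R]|.

End Counting.

Section CaterpillarHalin.
Variables (k : nat) (m : 'I_k -> nat).

(* Blocks of leaves are indexed from 0, so the even ones lie above the path.  *)
Definition block_size (j : 'I_k) : nat := m j + (0 < j < k.-1).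

Definition num_legs : nat := \sum_(j < k) block_size j.

(* inl i is the path vertex v_i, inr i the leaf u_(i+1).                      *)
Definition cat_vertex : finType := ('I_num_legs.+2 + 'I_num_legs)%type.

Definition upper (i : 'I_num_legs) : bool :=
  [exists j : 'I_k, ~~ odd j &&
     (\sum_(t < k | t < j) block_size t <= i
        < \sum_(t < k | t <= j) block_size t)].

Definition outer_cycle : seq cat_vertex :=
  inl ord0 :: [seq inr i | i <- enum 'I_num_legs & upper i]
  ++ inl ord_max :: [seq inr i | i <- rev (enum 'I_num_legs) & ~~ upper i].

Definition tree_arc (x y : cat_vertex) : bool :=
  match x, y with
  | inl i, inl j => j == i.+1 :> nat
  | inl i, inr j => i == j.+1 :> nat
  | _, _ => false
  end.

Definition cycle_arc (x y : cat_vertex) : bool :=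
  (x \in outer_cycle) && (y == next outer_cycle x).

Definition halin_adj : rel cat_vertex :=
  [rel x y | [|| tree_arc x y, tree_arc y x, cycle_arc x y | cycle_arc y x]].

Lemma halin_adj_sym : symmetric halin_adj.
Proof.
by move=> x y; rewrite /halin_adj /= orbCA [cycle_arc x y || _]orbC.
Qed.

Lemma outer_cycle_uniq : uniq outer_cycle.
Proof.
have inr_inj : injective (@inr 'I_num_legs.+2 'I_num_legs) by move=> ? ? [].
have Nl a s : (inl a \in [seq (inr i : cat_vertex) | i : 'I_num_legs <- s])
                = false.
  by apply/mapP=> -[].
rewrite /outer_cycle cons_uniq mem_cat in_cons !Nl cat_uniq cons_uniq /= !Nl /=.
have U p : uniq (filter p (enum 'I_num_legs)) by rewrite filter_uniq ?enum_uniq.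
rewrite !(map_inj_uniq inr_inj) filter_rev rev_uniq !U /=.
rewrite !andbT; apply/hasPn => _ /mapP[i + ->].
rewrite mem_rev mem_filter => /andP[lo _].
apply/mapP => -[j + [eij]]; rewrite mem_filter => /andP[up _].
by rewrite eij up in lo.
Qed.

Lemma halin_adj_irrefl : irreflexive halin_adj.
Proof.
move=> x; rewrite /halin_adj /=; have -> : tree_arc x x = false.
  by case: x => //= i; rewrite ltn_eqF.
rewrite /= orbb; apply/negP => /andP[Cx /eqP nx].
have U := outer_cycle_uniq.
have S : 1 < size outer_cycle by rewrite /= size_cat /= addnS.
case: (rot_to Cx) => i s def_s.
have := next_rot i U x; rewrite def_s -nx.
have : uniq (x :: s) by rewrite -def_s rot_uniq.
have : 1 < size (x :: s) by rewrite -def_s size_rot.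
case: s {def_s} => //= y s _ /andP[]; rewrite in_cons negb_or eqxx.
by move=> /andP[/eqP xy _] _ /esym.
Qed.

Definition caterpillar_halin : sgraph :=
  SGraph halin_adj_sym halin_adj_irrefl.

End CaterpillarHalin.

(* Main.v *)
Require Import Defs.
From mathcomp Require Import all_boot.
From mathcomp Require Import all_algebra all_fingroup mxabelem zify.

(* Fix the plane embedding of H. Relative to it, a rotation system amounts to *)
(* a choice of flipped vertices and a set A of twisted edges, where an edge   *)
(* counts as twisted if its own twist and the flips of its ends add up to 1.  *)
(* Every A comes from exactly two T-rotation systems. Two-colourings of the   *)
(* faces of the twisted embedding correspond to the kernel, over F_2, of the  *)
(* Laplacian of A viewed as a subgraph of the dual graph, so the Euler genus  *)
(* is the rank of that Laplacian. As the dual is simple, the rank is 0 only   *)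
(* for the empty A, and 1 only if A is the set of edges within a clique of    *)
(* positive even size (a symmetric matrix of rank 1 over F_2 is x x^T). In    *)
(* the dual the outer face is adjacent to all inner faces, so these cliques   *)
(* correspond to the nonempty cliques of inner faces. The inner faces form a  *)
(* 2-tree, in which each of the l faces after the first two is joined to two  *)
(* adjacent earlier ones: it has 1 + 2 + 4 l nonempty cliques.                *)

Set Implicit Arguments.
Unset Strict Implicit.
Unset Printing Implicit Defensive.
Import GRing.Theory.

(** * Edge sets and forests *)

(** Reversing the rotation at a vertex and toggling the twists of its edges leaves the set A of
    edges with [plane_twisted] unchanged, and the number of faces depends on A alone. As T carries
    no twists, A determines the flips up to one global reversal, and every A occurs: this is the
    factor 2 of [card_T_rotation_systems]. A two-colouring of the faces of the twisted embedding
    splits into a colouring theta of the plane faces and a colouring psi of the vertices. The two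
    fit together when the differences of theta across the edges of A form the cut of psi, and such a
    psi exists exactly when theta is in the kernel of [lap]. Counting both sides gives [card_faces],
    so the Euler characteristic is 2 minus the rank. Rank 0 forces A to be empty ([genus0E]). Rank 1
    always gives a nonorientable surface ([genus1E]) and corresponds to an even clique of the dual
    ([card_rank1]). For the caterpillar map, [cat_plane] supplies planarity and [card_even_cliques]
    finds 4 l + 3 such cliques; with l from [num_legsE], 2 (4 l + 3) is the required number. *)

Lemma eq_set2 (T : finType) (a b c d : T) :
  [set a; b] = [set c; d] -> (a = c /\ b = d) \/ (a = d /\ b = c).
Proof.
move=> E; have := set21 a b; have := set22 a b; rewrite E !inE.
have := set21 c d; have := set22 c d; rewrite -E !inE.
by do 4![case/orP => /eqP ?]; subst; auto.
Qed.

Definition bool_connected (G : sgraph) :=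
  forall s : G -> bool,
    (forall x y, adj x y -> s x = s y) -> forall x y, s x = s y.

Section Graph.
Variable G : sgraph.

Definition edges_of (r : rel G) : {set {set G}} :=
  [set [set p.1; p.2] | p : G * G & adj p.1 p.2 && r p.1 p.2].

Lemma mem_edges_of (r : rel G) x y :
  symmetric r -> [set x; y] \in edges_of r = adj x y && r x y.
Proof.
move=> sr; apply/imsetP/idP => [[[u v] /=]|xy]; last by exists (x, y); rewrite ?inE.
rewrite inE /= => uv /eq_set2[] [-> ->] //.
by rewrite adj_sym sr.
Qed.

Lemma mem_edges x y : ([set x; y] \in edges G) = adj x y.
Proof.
apply/imsetP/idP => [[[u v] /=]|xy]; last by exists (x, y); rewrite ?inE.
by rewrite inE /= => uv /eq_set2[] [-> ->]; rewrite // adj_sym.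
Qed.

Lemma eq_edges_of (r s : rel G) :
  (forall x y, adj x y -> r x y = s x y) -> edges_of r = edges_of s.
Proof.
move=> E; rewrite /edges_of (_ : [set p : G * G | adj p.1 p.2 && r p.1 p.2] =
  [set p : G * G | adj p.1 p.2 && s p.1 p.2]) //.
apply/setP => -[x y]; rewrite !inE /=.
by case: (boolP (adj x y)) => //= /E.
Qed.

Lemma edges_of_sub r : edges_of r \subset edges G.
Proof.
apply/subsetP => _ /imsetP[[u v] + ->]; rewrite inE /= => /andP[uv _].
by rewrite mem_edges.
Qed.

Lemma edges_ofK (A : {set {set G}}) :
  A \subset edges G -> edges_of (fun x y => [set x; y] \in A) = A.
Proof.
move=> /subsetP AE; apply/setP => e; apply/imsetP/idP => [[[u v]]|Ae].
  by rewrite inE /= => /andP[_ ?] ->.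
have /imsetP[[u v] /=] := AE _ Ae; rewrite inE /= => uv eE.
by exists (u, v); rewrite // inE /= uv -eE.
Qed.

Lemma edges_set2 e : e \in edges G -> exists x y, adj x y /\ e = [set x; y].
Proof. by case/imsetP=> [[x y]]; rewrite inE => xy ->; exists x, y. Qed.

Lemma edges_of_inj (r s : rel G) : symmetric r -> symmetric s ->
  (edges_of r == edges_of s) = [forall x, forall y, adj x y ==> (r x y == s x y)].
Proof.
move=> Sr Ss; apply/eqP/'forall_forallP => [E x y|E].
  apply/implyP => xy; move/setP/(_ [set x; y]): E.
  by rewrite !mem_edges_of // xy => /= ->.
apply: eq_edges_of => x y xy; apply/eqP.
by have /implyP/(_ xy) := E x y.
Qed.

Lemma card_darts : #|[set p : G * G | adj p.1 p.2]| = (2 * #|edges G|)%N.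
Proof.
rewrite -sum1_card mulnC -sum_nat_const.
rewrite (partition_big (fun p : G * G => [set p.1; p.2]) (mem (edges G))) /=; last first.
  by move=> [x y]; rewrite inE mem_edges.
apply: eq_bigr => e /edges_set2[x [y [xy ->]]].
rewrite sum1dep_card (_ : [set _ | _] = [set (x, y); (y, x)]) ?cards2.
  by rewrite xpair_eqE negb_and; case: eqP xy => // ->; rewrite adj_irrefl.
apply/setP => -[u v]; rewrite !inE /= !xpair_eqE.
apply/andP/orP => [[uv /eqP/eq_set2[] [-> ->]]|[]/andP[/eqP-> /eqP->]].
- by left; rewrite !eqxx.
- by right; rewrite !eqxx.
- by rewrite xy.
- by rewrite adj_sym xy setUC.
Qed.

(* Deleting an edge of a forest separates its ends, so a partial solution can *)
(* be flipped on one side to accommodate that edge.                           *)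
Lemma forest_coboundary (F : {set {set G}}) (a : rel G) :
  F \subset edges G ->
  (forall c, ucycle [rel x y : G | [set x; y] \in F] c -> size c <= 2) ->
  symmetric a ->
  exists s : G -> bool, forall x y, [set x; y] \in F -> a x y = s x (+) s y.
Proof.
move=> + + Sa; have [n] := ubnP #|F|; elim: n F => // n IHn F ltFn FE acyc.
have [->|[e Fe]] := set_0Vmem F; first by exists xpred0 => x y; rewrite inE.
have [x [y [xy def_e]]] := edges_set2 (subsetP FE _ Fe).
have sF'F : F :\ e \subset F by rewrite subD1set.
set eF' := [rel x y : G | [set x; y] \in F :\ e].
have SeF' : symmetric eF' by move=> u v; rewrite /= setUC.
have [|||s Hs] := IHn (F :\ e).
- by rewrite -ltnS; apply: leq_trans ltFn; rewrite (cardsD1 e F) Fe.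
- exact: subset_trans FE.
- case=> [|u c] // /andP[cyc uniq_c]; apply: acyc; apply/andP; split => //.
  by apply: sub_path cyc => v w /(subsetP sF'F).
(* A path from x to y avoiding e would close up through e to a cycle; acyclicity bounds it by two
   vertices, which makes it the deleted edge itself. *)
have Nxy : ~~ connect eF' x y.
  apply/negP => /connectP[p0 p0P]; case: (shortenP p0P) => p pP p_uniq _ def_y.
  have : size (x :: p) <= 2.
    apply: acyc; rewrite /ucycle p_uniq andbT /= rcons_path -def_y /=.
    rewrite setUC -def_e Fe andbT; apply: sub_path pP => u v.
    exact: (subsetP sF'F).
  case: p pP def_y {p_uniq} => [_ xy' _|z [|//] /= /andP[+ _] yz _].
    by move: xy; rewrite xy' adj_irrefl.
  by rewrite -yz -def_e !inE eqxx.
exists (fun z => s z (+) (connect eF' x z && (a x y (+) (s x (+) s y)))) => u v Fuv.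
have [Euv|/eqP Nuv] := eqVneq [set u; v] e.
  move: Euv; rewrite def_e => /eq_set2[] [-> ->].
    rewrite connect0 (negbTE Nxy) /= addbF.
    by case: (a x y); case: (s x); case: (s y).
  rewrite connect0 (negbTE Nxy) /= addbF Sa.
  by case: (a x y); case: (s x); case: (s y).
have F'uv : eF' u v by rewrite /= !inE Fuv andbT; apply/eqP.
rewrite (Hs u v F'uv).
have -> : connect eF' x u = connect eF' x v.
  exact: (same_connect_r (sym_connect_sym SeF') (connect1 F'uv)).
by case: (s u); case: (s v); case: (_ && _).
Qed.

Lemma spanning_tree_const (T : {set {set G}}) (s : G -> bool) :
  spanning_tree T -> (forall x y, [set x; y] \in T -> s x = s y) ->
  forall x y, s x = s y.
Proof.
case=> _ conT _ sT x y; case/connectP: (conT x y) => p + ->.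
by elim: p x => //= z p IHp x /andP[/sT-> /IHp].
Qed.

Lemma spanning_tree_connected (T : {set {set G}}) :
  spanning_tree T -> bool_connected G.
Proof.
move=> spT s sG; apply: (spanning_tree_const spT) => x y Txy; apply: sG.
by case: spT => /subsetP/(_ _ Txy); rewrite mem_edges.
Qed.

End Graph.

(** * Embedded cubic graphs *)

(* An embedded cubic graph with [n] faces: [nb0 v], [nb1 v], [nb2 v] are the  *)
(* neighbours of [v] in rotation order and [left_face x y] is the face to the *)
(* left of the arc [xy].                                                      *)
Record cubic_map (G : sgraph) (n : nat) := CubicMap {
  nb0 : G -> G;
  nb1 : G -> G;
  nb2 : G -> G;
  left_face : G -> G -> 'I_n;
  nbrsE : forall v, nbrs v = [set nb0 v; nb1 v; nb2 v];
  nb_uniq : forall v, uniq [:: nb0 v; nb1 v; nb2 v];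
  left_nb0 : forall v, left_face (nb0 v) v = left_face v (nb1 v);
  left_nb1 : forall v, left_face (nb1 v) v = left_face v (nb2 v);
  left_nb2 : forall v, left_face (nb2 v) v = left_face v (nb0 v);
  left_onto : forall f, exists x y, adj x y /\ left_face x y = f;
  left_neq : forall x y, adj x y -> left_face x y != left_face y x;
  dual_simple : forall x y x' y', adj x y -> adj x' y' ->
    left_face x y = left_face x' y' -> left_face y x = left_face y' x' ->
    (x, y) = (x', y') }.

(* [face_perp]: a set of edges meeting every face boundary evenly is a cut;   *)
(* [cycle_faces]: the face boundaries span the cycle space.                   *)
Record plane_map (G : sgraph) (n : nat) (P : cubic_map G n) : Prop := PlaneMap {
  face_perp : forall c : rel G, symmetric c ->
    (forall f, \sum_(p : G * G | adj p.1 p.2 && (left_face P p.1 p.2 == f))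
                 c p.1 p.2 = 0)%R ->
    exists psi : G -> bool, forall x y, adj x y -> c x y = psi x (+) psi y;
  cycle_faces : forall c : rel G, symmetric c ->
    (forall v, c v (nb0 P v) (+) c v (nb1 P v) (+) c v (nb2 P v) = false) ->
    exists theta : 'I_n -> bool, forall x y, adj x y ->
      c x y = theta (left_face P x y) (+) theta (left_face P y x);
  euler_plane : #|G| + n = #|edges G| + 2 }.

Section Rotation.
Variables (G : sgraph) (n : nat) (P : cubic_map G n).

Lemma nb_neq v : [/\ nb0 P v != nb1 P v, nb0 P v != nb2 P v & nb1 P v != nb2 P v].
Proof.
by have := nb_uniq P v; rewrite /= !inE negb_or andbT => /andP[/andP[-> ->] ->].
Qed.

Lemma adjE v w :
  adj v w = [|| w == nb0 P v, w == nb1 P v | w == nb2 P v].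
Proof.
by have /setP/(_ w) := nbrsE P v; rewrite !inE orbA.
Qed.

(** The 3-cycle [nb0] to [nb1] to [nb2] to [nb0]: products of permutations act from left to
    right. *)
Definition rot (v : G) : {perm G} :=
  (tperm (nb0 P v) (nb1 P v) * tperm (nb0 P v) (nb2 P v))%g.

Lemma handshake : 2 * #|edges G| = 3 * #|G|.
Proof.
rewrite -card_darts -sum1_card mulnC -sum_nat_const.
rewrite (eq_bigl (fun p : G * G => predT p.1 && adj p.1 p.2)); last first.
  by move=> p; rewrite inE.
rewrite -(pair_big_dep predT (fun x y => adj x y) (fun _ _ => 1)) /=.
apply: eq_bigr => v _; rewrite sum1dep_card.
have := nbrsE P v; rewrite /nbrs => ->; have [n01 n02 n12] := nb_neq v.
by rewrite setUC cardsU1 cards2 !inE n01 ![nb2 P v == _]eq_sym (negbTE n02) (negbTE n12).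
Qed.

Lemma rotE v : [/\ rot v (nb0 P v) = nb1 P v, rot v (nb1 P v) = nb2 P v
  & rot v (nb2 P v) = nb0 P v].
Proof.
have [n01 n02 n12] := nb_neq v.
rewrite /rot !permM tpermL tpermR tpermL; split=> //.
  by rewrite tpermD // eq_sym.
by rewrite (tpermD n02 n12) tpermR.
Qed.

Lemma rot_out v w : ~~ adj v w -> rot v w = w.
Proof.
rewrite (adjE v w) !negb_or => /and3P[w0 w1 w2].
by rewrite /rot permM !tpermD // eq_sym.
Qed.

Lemma adj_rot v w : adj v (rot v w) = adj v w.
Proof.
case: (boolP (adj v w)) => [|Nvw]; last by rewrite rot_out // (negbTE Nvw).
have [] := rotE v; rewrite !adjE => r0 r1 r2.
by case/or3P=> /eqP->; rewrite ?r0 ?r1 ?r2 eqxx ?orbT.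
Qed.

Lemma adj_rotV v w : adj v ((rot v)^-1%g w) = adj v w.
Proof. by rewrite -{2}[w](permKV (rot v)) adj_rot. Qed.

Lemma left_rot x y : adj y x -> left_face P x y = left_face P y (rot y x).
Proof.
have [r0 r1 r2] := rotE y.
rewrite adjE => /or3P[]/eqP->; rewrite ?r0 ?r1 ?r2.
- exact: left_nb0.
- exact: left_nb1.
- exact: left_nb2.
Qed.

Definition rotb (b : bool) (v : G) : {perm G} :=
  if b then (rot v)^-1%g else rot v.

Definition side (x y : G) (b : bool) :=
  if b then left_face P y x else left_face P x y.

Lemma adj_rotb b v w : adj v (rotb b v w) = adj v w.
Proof. by case: b; rewrite /= ?adj_rotV ?adj_rot. Qed.

(** A walk that keeps a plane face on a given side and turns accordingly at y stays along the same
    plane face. *)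
Lemma side_rotb b x y : adj y x -> side y (rotb b y x) b = side x y b.
Proof.
case: b => yx /=; last by rewrite -left_rot.
by rewrite left_rot ?adj_rotV // permKV.
Qed.

Lemma sideN x y b : side x y (~~ b) = side y x b.
Proof. by case: b. Qed.

Lemma porbit_sub (T : finType) (s : {perm T}) (C : {set T}) x :
  (forall y, y \in C -> s y \in C) -> x \in C -> porbit s x \subset C.
Proof.
move=> sC Cx; apply/subsetP => _ /porbitP[i ->].
by elim: i => [|i IHi]; rewrite ?perm1 // expgSr permM sC.
Qed.

(** Three neighbours admit just two cyclic orders. Fixed points ([fixN]) and 2-cycles ([swapN]) are
    excluded because their orbits would miss a neighbour. *)
Lemma perm_on_full (s : {perm G}) v :
  perm_on (nbrs v) s && [forall w in nbrs v, porbit s w == nbrs v] ->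
  s = rot v \/ s = (rot v)^-1%g.
Proof.
move=> /andP[s_on /forallP s_full]; have [r0 r1 r2] := rotE v.
have [n01 n02 n12] := nb_neq v.
have [n10 n20 n21] : [/\ nb1 P v != nb0 P v, nb2 P v != nb0 P v
  & nb2 P v != nb1 P v].
  by rewrite ![nb2 P v == _]eq_sym eq_sym.
have full (C : {set G}) w z : w \in C -> adj v w -> adj v z ->
    (forall y, y \in C -> s y \in C) -> z \in C.
  move=> Cw vw vz /porbit_sub/(_ Cw)/subsetP; apply.
  by have := s_full w; rewrite inE vw /= => /eqP->; rewrite inE.
have s_nb w : adj v (s w) = adj v w by have := perm_closed w s_on; rewrite !inE.
have s_out w : ~~ adj v w -> s w = w by move=> vw; rewrite (out_perm s_on) ?inE.
have [v0 v1 v2] : [/\ adj v (nb0 P v), adj v (nb1 P v) & adj v (nb2 P v)].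
  by rewrite !adjE !eqxx !orbT.
have fixN w z : adj v w -> adj v z -> z != w -> s w != w.
  move=> vw vz; apply: contraNneq => sw.
  have := full [set w] w z; rewrite !inE => -> // y.
  by rewrite !inE => /eqP->; apply/eqP.
have swapN w y z : adj v w -> adj v z -> z != w -> z != y -> s w = y -> s y != w.
  move=> vw vz zw zy sw; apply/eqP => sy.
  have := full [set w; y] w z; rewrite set21 => /(_ isT vw vz).
  rewrite !inE (negbTE zw) (negbTE zy) => H; have //: false; apply: H => x.
  by rewrite !inE => /orP[]/eqP->; rewrite ?sw ?sy eqxx ?orbT.
have := s_nb (nb0 P v); rewrite v0 adjE => /or3P[]/eqP s0.
- by have := fixN _ _ v0 v1; rewrite eq_sym s0 eqxx => /(_ n01).
- have s1 : s (nb1 P v) = nb2 P v.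
    have := s_nb (nb1 P v); rewrite v1 adjE => /or3P[]/eqP // s1.
      by have := swapN _ _ _ v0 v2 n20 n21 s0; rewrite s1 eqxx.
    by case/eqP: n01; apply: (@perm_inj _ s); rewrite s0 s1.
  have s2 : s (nb2 P v) = nb0 P v.
    have := s_nb (nb2 P v); rewrite v2 adjE => /or3P[]/eqP // s2.
      by case/eqP: n02; apply: (@perm_inj _ s); rewrite s0 s2.
    by case/eqP: n12; apply: (@perm_inj _ s); rewrite s1 s2.
  left; apply/permP => w.
  case: (boolP (adj v w)) => [|Nw]; last by rewrite s_out ?rot_out.
  by rewrite adjE => /or3P[]/eqP->; rewrite ?s0 ?s1 ?s2 ?r0 ?r1 ?r2.
- have s2 : s (nb2 P v) = nb1 P v.
    have := s_nb (nb2 P v); rewrite v2 adjE => /or3P[]/eqP // s2.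
      by have := swapN _ _ _ v0 v1 n10 n12 s0; rewrite s2 eqxx.
    by case/eqP: n02; apply: (@perm_inj _ s); rewrite s0 s2.
  have s1 : s (nb1 P v) = nb0 P v.
    have := s_nb (nb1 P v); rewrite v1 adjE => /or3P[]/eqP // s1.
      by case/eqP: n12; apply: (@perm_inj _ s); rewrite s1 s2.
    by case/eqP: n01; apply: (@perm_inj _ s); rewrite s0 s1.
  right; apply/permP => w; apply: (@perm_inj _ (rot v)); rewrite permKV.
  case: (boolP (adj v w)) => [|Nw]; last by rewrite s_out ?rot_out.
  by rewrite adjE => /or3P[]/eqP->; rewrite ?s0 ?s1 ?s2 ?r0 ?r1 ?r2.
Qed.

Lemma rotb_full b v :
  perm_on (nbrs v) (rotb b v) &&
  [forall w in nbrs v, porbit (rotb b v) w == nbrs v].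
Proof.
apply/andP; split.
  apply/subsetP => w; rewrite !inE; apply: contraR => Nw.
  have rw := rot_out Nw; case: b => /=; last by rewrite rw.
  by rewrite -[X in _ == X]rw -{1}rw permK rw.
have r w : adj v w -> porbit (rot v) w = nbrs v.
  move=> vw; apply/eqP; rewrite eqEsubset porbit_sub ?inE //=; last first.
    by move=> y; rewrite !inE adj_rot.
  have [r0 r1 r2] := rotE v.
  have m1 : rot v w \in porbit (rot v) w := mem_porbit _ 1 _.
  have m2 : rot v (rot v w) \in porbit (rot v) w.
    by have := mem_porbit (rot v) 2 w; rewrite expgS expg1 permM.
  apply/subsetP => z; rewrite inE; move: vw m1 m2 (porbit_id (rot v) w).
  by rewrite !adjE => /or3P[]/eqP->; rewrite ?(r0, r1, r2) => ? ? ? /or3P[]/eqP->.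
apply/forallP => w; rewrite inE; apply/implyP => /r <-.
by case: b; rewrite //= porbitV.
Qed.

Lemma rot_neqV v : rot v != (rot v)^-1%g.
Proof.
have [r0 r1 r2] := rotE v; have [n01 n02 n12] := nb_neq v.
apply: contraNneq n02 => /(congr1 (fun s : {perm G} => s (rot v (nb0 P v)))).
by rewrite permK r0 r1 => ->.
Qed.

Definition flip (R : rotation_data G) (v : G) : bool := R.1 v != rot v.

Lemma flipP (R : rotation_data G) v :
  pure_rotation_system R.1 -> R.1 v = rotb (flip R v) v.
Proof.
move=> /forallP/(_ v)/perm_on_full; rewrite /flip /rotb.
by case=> ->; rewrite ?eqxx //= eq_sym rot_neqV.
Qed.

Lemma pure_rotationP (rho : {ffun G -> {perm G}}) (s : G -> bool) :
  (forall v, rho v = rotb (s v) v) -> pure_rotation_system rho.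
Proof. by move=> E; apply/forallP => v; rewrite E; exact: rotb_full. Qed.

End Rotation.

(** * Faces of a twisted embedding *)

Section Faces.
Variables (G : sgraph) (R : rotation_data G).

Lemma twistedC x y : twisted R x y = twisted R y x.
Proof. by rewrite /twisted setUC. Qed.

Lemma face_revK : involutive (face_rev R).
Proof.
case=> [[x y] s]; rewrite /face_rev /= [twisted R y x]twistedC.
by case: s; case: twisted.
Qed.

(** Reversal conjugates the face step to its inverse; hence the step is injective, and a face is the
    same set from any of its flags in either direction. *)
Lemma face_step_rev f : face_step R (face_rev R (face_step R f)) = face_rev R f.
Proof.
case: f => [[x y] s] /=; set s' := s (+) _.
set z := if s' then _ else _; rewrite [twisted R z y]twistedC.
have -> : ~~ (s' (+) twisted R y z) (+) twisted R y z = ~~ s'.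
  by rewrite addNb addbK.
rewrite /z => {z}; case: s' => /=;
  by rewrite ?permK ?permKV.
Qed.

Lemma face_step_inj : injective (face_step R).
Proof.
move=> f g /(congr1 (face_rev R))/(congr1 (face_step R)).
by rewrite !face_step_rev => /(inv_inj face_revK).
Qed.

Lemma face_of_step f : face_of R (face_step R f) = face_of R f.
Proof.
apply/setP => g; rewrite !inE -(same_fconnect1 face_step_inj).
by congr (_ || _); rewrite -(face_step_rev f) -(same_fconnect1 face_step_inj).
Qed.

Lemma face_of_rev f : face_of R (face_rev R f) = face_of R f.
Proof. by apply/setP => g; rewrite !inE face_revK orbC. Qed.

Lemma face_of_self f : f \in face_of R f.
Proof. by rewrite inE connect0. Qed.

Lemma face_of_invariant (D : {pred flag G}) (phi : flag G -> bool) f g :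
  (forall h, h \in D -> face_step R h \in D) ->
  (forall h, h \in D -> face_rev R h \in D) ->
  (forall h, h \in D -> phi (face_step R h) = phi h) ->
  (forall h, h \in D -> phi (face_rev R h) = phi h) ->
  f \in D -> g \in face_of R f -> phi g = phi f.
Proof.
move=> stepD revD phi_step phi_rev Df.
have iter_phi h k : h \in D ->
    iter k (face_step R) h \in D /\ phi (iter k (face_step R) h) = phi h.
  by move=> Dh; elim: k => //= k [IH1 IH2]; rewrite stepD // phi_step.
rewrite inE => /orP[]/iter_findex <-.
  by have [] := iter_phi f (findex (face_step R) f g) Df.
have [] := iter_phi _ (findex (face_step R) (face_rev R f) g) (revD _ Df).
by move=> _ ->; rewrite phi_rev.
Qed.

End Faces.

(** * The Laplacian of a set of edges in the dual graph *)

Section DualLaplacian.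
Variables (G : sgraph) (n : nat) (P : cubic_map G n).
Local Open Scope ring_scope.

(* Over F_2, the Laplacian of the subgraph of the dual formed by the edges    *)
(* dual to those in [a]; a bool coefficient [x && y] is a product and         *)
(* [x (+) y] a sum.                                                           *)
Definition lap (a : rel G) : 'M[bool]_n :=
  \matrix_(g, f) \sum_(p : G * G | adj p.1 p.2 && (left_face P p.1 p.2 == f))
     (a p.1 p.2 && ((g == left_face P p.1 p.2) (+) (g == left_face P p.2 p.1))).

Lemma mul_lapE (theta : 'rV_n) (a : rel G) f :
  (theta *m lap a) 0 f =
  \sum_(p : G * G | adj p.1 p.2 && (left_face P p.1 p.2 == f))
     (a p.1 p.2 && (theta 0 (left_face P p.1 p.2)
                    (+) theta 0 (left_face P p.2 p.1))).
Proof.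
rewrite mxE; under eq_bigr do rewrite mxE big_distrr /=.
rewrite exchange_big /=; apply: eq_bigr => -[x y] _ /=.
have sum1 h : \sum_g theta 0 g * (g == h) = theta 0 h.
  rewrite (bigD1 h) //= eqxx mulr1 big1 ?addr0 // => g /negbTE->.
  by rewrite mulr0.
rewrite -[X in X (+) _]sum1 -[X in _ (+) X]sum1 -[_ (+) _]/(_ + _) -big_split /=.
have andM (b c : bool) : b && c = b * c by [].
rewrite andM big_distrr; apply: eq_bigr => g _ /=.
by case: (theta 0 g); case: (a x y); case: (_ == _); case: (_ == _).
Qed.

(** Sending an arc to the next arc of its face permutes the boundary of f, so tails and heads
    contribute equally and cancel over F_2. *)
Lemma sum_face_ends (psi : G -> bool) f :
  \sum_(p : G * G | adj p.1 p.2 && (left_face P p.1 p.2 == f))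
     (psi p.1 (+) psi p.2) = 0.
Proof.
rewrite [LHS]big_split /=; set S2 := (X in _ + X).
rewrite (reindex_inj (h := fun p : G * G => (p.2, rot P p.2 p.1))) /=; last first.
  by move=> [x y] [x' y'] /= [-> /perm_inj->].
rewrite (eq_bigl (fun p : G * G => adj p.1 p.2 && (left_face P p.1 p.2 == f))).
  exact: addbb.
move=> [x y] /=; rewrite adj_rot adj_sym.
by case: (boolP (adj x y)) => //= xy; rewrite -left_rot // adj_sym.
Qed.

End DualLaplacian.

(** * Face colourings of a twisted embedding in plane coordinates *)

Section FaceTracing.
Variables (G : sgraph) (n : nat) (P : cubic_map G n) (R : rotation_data G).
Hypothesis rotR : pure_rotation_system R.1.

Definition plane_twisted (x y : G) : bool :=
  twisted R x y (+) (flip P R x (+) flip P R y).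

Lemma plane_twistedC : symmetric plane_twisted.
Proof. by move=> x y; rewrite /plane_twisted twistedC [flip _ _ _ (+) _]addbC. Qed.

Lemma face_stepE x y s : face_step R (x, y, s) =
  (y, rotb P (s (+) twisted R x y (+) flip P R y) y x, s (+) twisted R x y).
Proof.
rewrite /= (flipP P y rotR); congr (_, _, _); rewrite /rotb.
by case: (s (+) _); case: flip; rewrite //= ?invgK.
Qed.

Lemma face_step_flags f : f \in flags G -> face_step R f \in flags G.
Proof. by case: f => [[x y] s]; rewrite face_stepE !inE /= adj_rotb adj_sym. Qed.

Lemma face_rev_flags f : f \in flags G -> face_rev R f \in flags G.
Proof. by case: f => [[x y] s]; rewrite !inE /= adj_sym. Qed.

(* A colouring of the face corners of the plane map that splits into a face   *)
(* part [theta] and a vertex part [psi]. It is constant along the faces of    *)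
(* [R] iff the pair is [balanced], and every colouring of the faces of [R]    *)
(* arises so: its differences across edges form a cycle.                      *)
Definition potential (theta : 'rV[bool]_n) (psi : G -> bool) (f : flag G) : bool :=
  let: (x, y, s) := f in psi x (+) theta 0%R (side P x y (s (+) flip P R x)).

Definition balanced (theta : 'rV[bool]_n) (psi : G -> bool) : Prop :=
  forall x y, adj x y ->
    plane_twisted x y
      && (theta 0%R (left_face P x y) (+) theta 0%R (left_face P y x))
    = psi x (+) psi y.

(** Along a plane-twisted edge the walk changes from one plane face to the other; the change of
    theta is made up for by the change of psi. *)
Lemma balanced_side theta psi x y b : balanced theta psi -> adj x y ->
  psi y (+) theta 0%R (side P x y (b (+) plane_twisted x y)) =
  psi x (+) theta 0%R (side P x y b).
Proof.
move=> bal xy; have := bal x y xy; rewrite /side.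
by case: plane_twisted; case: b; case: (psi x); case: (psi y);
   case: (theta 0%R (left_face P x y)); case: (theta 0%R (left_face P y x)).
Qed.

Lemma potential_step theta psi f : balanced theta psi -> f \in flags G ->
  potential theta psi (face_step R f) = potential theta psi f.
Proof.
case: f => [[x y] s] bal Ff; have xy : adj x y by move: Ff; rewrite inE.
rewrite face_stepE /potential {Ff}.
rewrite side_rotb 1?adj_sym // -(balanced_side _ bal xy) /plane_twisted.
by congr (_ (+) theta _ (side _ _ _ _)); case: s; case: twisted; do 2!case: flip.
Qed.

Lemma potential_rev theta psi f : balanced theta psi -> f \in flags G ->
  potential theta psi (face_rev R f) = potential theta psi f.
Proof.
case: f => [[x y] s] bal; rewrite inE /= => xy.
rewrite -(balanced_side _ bal xy) -sideN /plane_twisted.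
by congr (_ (+) theta _ (side _ _ _ _)); case: s; case: twisted; do 2!case: flip.
Qed.

Lemma potential_face theta psi f g : balanced theta psi -> f \in flags G ->
  face_of R f = face_of R g -> potential theta psi f = potential theta psi g.
Proof.
move=> bal Ff Efg; apply/esym.
apply: (face_of_invariant (R := R) (D := mem (flags G))) => //.
- exact: face_step_flags.
- exact: face_rev_flags.
- by move=> h; apply: potential_step.
- by move=> h; apply: potential_rev.
- by rewrite Efg face_of_self.
Qed.

End FaceTracing.

(** * The number of faces as the corank of the dual Laplacian *)

Section FaceCount.
Variables (G : sgraph) (n : nat) (P : cubic_map G n) (R : rotation_data G).
Hypothesis planeP : plane_map P.
Hypothesis connG : bool_connected G.
Hypothesis rotR : pure_rotation_system R.1.
Variable r : G.
Let ptw := plane_twisted P R.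

(** Adding 1 to both theta and psi does not change the potential; requiring psi to vanish at r
    removes this redundancy. *)
Definition balanced_pairs : {set 'rV[bool]_n * {ffun G -> bool}} :=
  [set tp : 'rV[bool]_n * {ffun G -> bool} | ~~ tp.2 r &&
    [forall p : G * G, adj p.1 p.2 ==>
      (ptw p.1 p.2 && (tp.1 0%R (left_face P p.1 p.2)
                       (+) tp.1 0%R (left_face P p.2 p.1))
       == tp.2 p.1 (+) tp.2 p.2)]].

Lemma balanced_pairsP (tp : 'rV[bool]_n * {ffun G -> bool}) :
  reflect (~~ tp.2 r /\ balanced P R tp.1 tp.2) (tp \in balanced_pairs).
Proof.
rewrite inE; apply: (iffP andP) => -[psi_r bal]; split => //.
  by move=> x y xy; have /forallP/(_ (x, y)) := bal; rewrite /= xy => /eqP.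
by apply/forallP => -[x y] /=; apply/implyP => /bal->.
Qed.

(** By connectedness theta determines the normalised psi. Some psi exists when the differences of
    theta over the twisted edges form a cut, which by [face_perp] means that they sum to 0 around
    each plane face: this is the kernel equation. *)
Lemma card_balanced_ker : #|balanced_pairs| = #|rowg (kermx (lap P ptw))|.
Proof.
rewrite -(card_in_imset (f := fst)); last first.
  move=> [th1 ps1] [th2 ps2].
  move=> /balanced_pairsP[/= r1 b1] /balanced_pairsP[/= r2 b2] E.
  rewrite {}E in b1 *; congr (_, _); apply/ffunP => x.
  have d12 u v : adj u v -> ps1 u (+) ps2 u = ps1 v (+) ps2 v.
    move=> uv; have := b1 u v uv; rewrite (b2 u v uv).
    by case: (ps1 u); case: (ps1 v); case: (ps2 u); case: (ps2 v).
  have := connG d12 x r; rewrite (negbTE r1) (negbTE r2).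
  by case: (ps1 x); case: (ps2 x).
congr #|pred_of_set _|; apply/setP => th; rewrite mem_rowg.
apply/imsetP/sub_kermxP => [[[th' psi] /balanced_pairsP[_ /= bal] ->]|ker_th].
  apply/rowP => f; rewrite mul_lapE mxE -[RHS](sum_face_ends P psi f).
  by apply: eq_bigr => -[x y] /andP[/= xy _]; apply: bal.
have [||psi bal] := face_perp planeP (c := fun x y =>
    ptw x y && (th 0%R (left_face P x y) (+) th 0%R (left_face P y x))).
- by move=> x y; rewrite /ptw plane_twistedC addbC.
- by move=> f; rewrite -mul_lapE ker_th mxE.
exists (th, [ffun x => psi x (+) psi r]) => //; apply/balanced_pairsP; split => /=.
  by rewrite ffunE addbb.
by move=> x y /bal bxy; rewrite !ffunE addbACA addbb addbF -bxy.
Qed.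

Definition potential_faces (tp : 'rV[bool]_n * {ffun G -> bool}) :
    {set {set flag G}} :=
  [set face_of R f | f in [set f in flags G | potential P R tp.1 tp.2 f]].

Lemma mem_potential_faces (tp : 'rV[bool]_n * {ffun G -> bool}) f :
  balanced P R tp.1 tp.2 -> f \in flags G ->
  (face_of R f \in potential_faces tp) = potential P R tp.1 tp.2 f.
Proof.
move=> bal Ff; apply/imsetP/idP => [[g]|pf]; last first.
  by exists f; rewrite // !inE in Ff *; apply/andP.
by rewrite inE => /andP[_ pg] E; rewrite (potential_face rotR bal Ff E).
Qed.

Lemma potential_faces_inj : {in balanced_pairs &, injective potential_faces}.
Proof.
move=> [th1 ps1] [th2 ps2].
move=> /balanced_pairsP[/= r1 b1] /balanced_pairsP[/= r2 b2] E.
have eq_pot x y b : adj x y ->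
    ps1 x (+) th1 0%R (side P x y b) = ps2 x (+) th2 0%R (side P x y b).
  move=> xy; have Ff : (x, y, b (+) flip P R x) \in flags G by rewrite inE.
  have := mem_potential_faces (tp := (th1, ps1)) b1 Ff.
  by rewrite E mem_potential_faces //= -addbA addbb addbF.
have eq_ps : ps1 = ps2.
  apply/ffunP => x.
  (* Both ends of uv have a corner on the left face of uv, so the theta terms cancel. *)
  have d12 u v : adj u v -> ps1 u (+) ps2 u = ps1 v (+) ps2 v.
    move=> uv; have vu : adj v u by rewrite adj_sym.
    have := eq_pot u v false uv; have := eq_pot v u true vu; rewrite /=.
    by case: (ps1 u); case: (ps1 v); case: (ps2 u); case: (ps2 v);
       case: (th1 _ _); case: (th2 _ _).
  have := connG d12 x r; rewrite (negbTE r1) (negbTE r2).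
  by case: (ps1 x); case: (ps2 x).
rewrite eq_ps; congr (_, _); apply/rowP => f.
have [x [y [xy <-]]] := left_onto P f.
by have := eq_pot x y false xy; rewrite eq_ps => /addbI.
Qed.

(** Read the colouring S at the corners of the plane map as [chi]. Its differences [c] across edges
    telescope around each vertex, so they form a cycle and [cycle_faces] yields theta. Subtracting
    theta leaves a value constant on the corners at each vertex, which is psi. *)
Lemma potential_faces_onto (S : {set {set flag G}}) : S \subset faces R ->
  exists2 tp, tp \in balanced_pairs & S = potential_faces tp.
Proof.
move=> SF.
pose chi x y b := face_of R (x, y, b (+) flip P R x) \in S.
have chi_rev x y b : chi x y b = chi y x (~~ (b (+) ptw x y)).
  rewrite /chi -face_of_rev /=; congr (face_of R (y, x, _) \in S).
  by rewrite /ptw /plane_twisted; case: b; case: twisted; do 2!case: flip.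
have chi_rot x y b : chi y (rotb P b y x) b = chi y x (~~ b).
  rewrite -[b in RHS](addbK (ptw x y)) -chi_rev /chi.
  rewrite -[in RHS]face_of_step (face_stepE P rotR).
  congr (face_of R (y, rotb P _ y x, _) \in S).
    by rewrite /ptw /plane_twisted; case: b; case: twisted; do 2!case: flip.
  by rewrite /ptw /plane_twisted; case: b; case: twisted; do 2!case: flip.
pose c x y := chi x y false (+) chi x y true.
have cC : symmetric c.
  by move=> x y; rewrite /c (chi_rev x) (chi_rev x y true); case: ptw; rewrite //= addbC.
have [|theta c_theta] := cycle_faces planeP cC.
  move=> v; have [r0 r1 r2] := rotE P v.
  have := chi_rot (nb0 P v) v false; have := chi_rot (nb1 P v) v false.
  have := chi_rot (nb2 P v) v false; rewrite /= r0 r1 r2 /c => -> -> ->.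
  by do 3!case: (chi _ _ _).
pose psi y := chi y (nb0 P y) false (+) theta (left_face P y (nb0 P y)).
have psiE x y b : adj x y -> psi x (+) theta (side P x y b) = chi x y b.
  move=> xy; have [r0 r1 r2] := rotE P x.
  pose D y := chi x y false (+) theta (left_face P x y).
  have Drot z : adj x z -> D (rot P x z) = D z.
    move=> xz; rewrite /D -left_rot // (chi_rot z x false).
    have := c_theta x z xz; rewrite /c.
    by do 2!case: (chi _ _ _); do 2!case: (theta _).
  have [v0 v1 v2] : [/\ adj x (nb0 P x), adj x (nb1 P x) & adj x (nb2 P x)].
    by rewrite !(adjE P) !eqxx !orbT.
  have Dxy : D y = psi x.
    have D1 := Drot _ v0; have D2 := Drot _ v1; rewrite r0 in D1; rewrite r1 in D2.
    by move: xy; rewrite (adjE P) => /or3P[]/eqP-> //; rewrite ?D2.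
  rewrite -Dxy /D; case: b => /=; last by rewrite addbK.
  have := c_theta x y xy; rewrite /c.
  by do 2!case: (chi _ _ _); do 2!case: (theta _).
(* Shifting both parts by psi r normalises psi at r and keeps the potential. *)
pose tp : 'rV[bool]_n * {ffun G -> bool} :=
  (\row_f (theta f (+) psi r), [ffun x => psi x (+) psi r])%R.
have tpE x y b : adj x y -> tp.2 x (+) tp.1 0%R (side P x y b) = chi x y b.
  by move=> xy; rewrite -psiE // ffunE mxE addbACA addbb addbF.
have bal : balanced P R tp.1 tp.2.
  move=> x y xy; have yx : adj y x by rewrite adj_sym.
  have := chi_rev x y false; rewrite -!tpE // sideN /side /= -/(ptw x y).
  by case: ptw; case: (tp.2 x); case: (tp.2 y); do 2!case: (tp.1 _ _).
have tp_bal : tp \in balanced_pairs.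
  by apply/balanced_pairsP; split; rewrite //= ffunE addbb.
exists tp => //; apply/setP => F; apply/idP/idP => [SFF|].
  have /imsetP[f Ff FE] := subsetP SF _ SFF.
  rewrite FE mem_potential_faces //.
  case: f Ff FE => [[x y] s]; rewrite inE /= => xy FE.
  by rewrite tpE // /chi addbK -FE.
case/imsetP=> -[[x y] s]; rewrite !inE /= => /andP[xy]; rewrite tpE // /chi.
by rewrite addbK => ? ->.
Qed.

Lemma card_faces : #|faces R| = n - \rank (lap P ptw).
Proof.
have E : 2 ^ #|faces R| = 2 ^ (n - \rank (lap P ptw)).
  rewrite -card_powerset -mxrank_ker -card_bool -card_rowg -card_balanced_ker.
  rewrite -(card_in_imset potential_faces_inj); congr #|pred_of_set _|.
  apply/setP => S; rewrite inE; apply/idP/imsetP => [/potential_faces_onto //|].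
  case=> tp _ ->; apply/subsetP => F /imsetP[f]; rewrite inE => /andP[Ff _] ->.
  exact: imset_f.
by apply/eqP; rewrite -(eqn_exp2l _ _ (isT : 1 < 2)) E.
Qed.

End FaceCount.

(** * Rank of the dual Laplacian *)

(** All rows are multiples of one nonzero row i0. By symmetry its diagonal entry is 1, since
    otherwise the row would vanish; the multiplier of row i is then the entry at (i0, i). *)
Lemma sym_rank1_bool n (L : 'M[bool]_n) :
  (forall i j, L i j = L j i) -> \rank L = 1 ->
  exists i0, forall i j, L i j = L i0 i && L i0 j.
Proof.
move=> symL rk1.
have [i0 i0_neq0] : exists i0, row i0 L != 0%R.
  apply/existsP; apply: contraT; rewrite negb_exists => /forallP r0.
  suff L0 : L = 0%R by rewrite L0 mxrank0 in rk1.
  by apply/row_matrixP => i; rewrite row0; apply/eqP; rewrite -[_ == _]negbK.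
have L_sub : (L <= row i0 L)%MS.
  by rewrite -(geq_leqif (mxrank_leqif_sup (row_sub i0 L))) rk1 lt0n mxrank_eq0.
have rowL i : exists c, forall j, L i j = (c * L i0 j)%R.
  have /sub_rVP[c /rowP Ec] := submx_trans (row_sub i L) L_sub.
  by exists c => j; have := Ec j; rewrite !mxE.
have L00 : L i0 i0 = true.
  apply: contraNT i0_neq0 => /negbTE L00; apply/eqP/rowP => j; rewrite !mxE symL.
  by have [c ->] := rowL j; rewrite L00 mulr0.
exists i0 => i j; have [c Ec] := rowL i; rewrite Ec; congr (_ * _)%R.
by rewrite symL Ec L00 mulr1.
Qed.

Section LaplacianRank.
Variables (G : sgraph) (n : nat) (P : cubic_map G n).
Local Open Scope ring_scope.

Lemma eq_lap (a b : rel G) :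
  (forall x y, adj x y -> a x y = b x y) -> lap P a = lap P b.
Proof.
move=> ab; apply/matrixP => g f; rewrite !mxE.
by apply: eq_bigr => -[x y] /andP[/= /ab ->].
Qed.

(** Since the dual is simple, only the arc xy contributes to this off-diagonal entry. *)
Lemma lap_edge a x y : adj x y -> lap P a (left_face P y x) (left_face P x y) = a x y.
Proof.
move=> xy; rewrite mxE (bigD1 (x, y)) /= ?xy ?eqxx //= eq_sym (negbTE (left_neq P xy)).
rewrite andbT big1 ?addr0 // => -[u v] /= /andP[/andP[uv /eqP uvl] Nuv].
rewrite uvl [_ == left_face P x y]eq_sym (negbTE (left_neq P xy)) /=.
case: eqP => [vul|_]; last by rewrite andbF.
by case/eqP: Nuv; apply: dual_simple uvl _.
Qed.

Lemma lap_nonadj a f g : f != g ->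
  (forall x y, adj x y -> left_face P x y = f -> left_face P y x <> g) ->
  lap P a g f = 0.
Proof.
move=> fg Nadj; rewrite mxE big1 // => -[x y] /= /andP[xy /eqP xyf].
rewrite xyf eq_sym (negbTE fg) /=; case: eqP => [/esym/Nadj|]; last by rewrite andbF.
by case.
Qed.

Lemma dual_adj_dec f g :
  {xy | [/\ adj xy.1 xy.2, left_face P xy.1 xy.2 = f & left_face P xy.2 xy.1 = g]} +
  (forall x y, adj x y -> left_face P x y = f -> left_face P y x <> g).
Proof.
case: (pickP (fun p : G * G =>
  [&& adj p.1 p.2, left_face P p.1 p.2 == f & left_face P p.2 p.1 == g])).
  by move=> p /and3P[? /eqP ? /eqP ?]; left; exists p.
by move=> N; right=> x y xy xyf yxg; have := N (x, y); rewrite /= xy xyf yxg !eqxx.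
Qed.

Lemma lap_sym (a : rel G) f g : symmetric a -> lap P a g f = lap P a f g.
Proof.
move=> Sa; have [->//|fg] := eqVneq f g.
case: (dual_adj_dec f g) => [[[x y] /= [xy <- <-]]|N].
  by rewrite lap_edge // lap_edge 1?adj_sym // Sa.
rewrite !lap_nonadj // 1?eq_sym // => x y xy xyg yxf.
by apply: (N y x); rewrite // adj_sym.
Qed.

Lemma lap_col_sum (a : rel G) f : \sum_g lap P a g f = 0.
Proof.
under eq_bigr do rewrite mxE; rewrite exchange_big big1 // => -[x y] _ /=.
have one h : \sum_(g : 'I_n) (g == h) = true.
  by rewrite (bigD1 h) //= eqxx big1 // => g /negbTE->.
case: (a x y) => /=; last by rewrite big1.
by rewrite [LHS]big_split /= !one.
Qed.

Lemma lap_diag (a : rel G) f :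
  lap P a f f =
  \sum_(p : G * G | adj p.1 p.2 && (left_face P p.1 p.2 == f)) a p.1 p.2.
Proof.
rewrite mxE; apply: eq_bigr => -[x y] /= /andP[xy /eqP <-].
by rewrite eqxx (negbTE (left_neq P xy)) andbT.
Qed.

Lemma lap_eq0 (a : rel G) : lap P a = 0 -> forall x y, adj x y -> a x y = false.
Proof. by move=> L0 x y /(lap_edge a) <-; rewrite L0 mxE. Qed.

Lemma sum_mem_bool (I : finType) (X : {set I}) : \sum_i (i \in X) = odd #|X|.
Proof.
rewrite (bigID (mem X)) /= [X in _ + X]big1 ?addr0; last by move=> i /negbTE.
rewrite (eq_bigr (fun _ => true)); last by move=> i ->.
rewrite sumr_const; elim: #|X| => // k IHk.
by rewrite mulrS IHk.
Qed.

Definition dual_clique (X : {set 'I_n}) : bool :=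
  [forall f in X, forall g in X, (f != g) ==>
    [exists p : G * G,
      [&& adj p.1 p.2, left_face P p.1 p.2 == f & left_face P p.2 p.1 == g]]].

Lemma dual_cliqueP (X : {set 'I_n}) :
  reflect (forall f g, f \in X -> g \in X -> f != g ->
             exists x y, [/\ adj x y, left_face P x y = f & left_face P y x = g])
          (dual_clique X).
Proof.
apply: (iffP forallP) => [H f g fX gX fg|H f].
  have := H f; rewrite fX => /forallP/(_ g); rewrite gX fg /=.
  by case/existsP=> -[x y] /= /and3P[? /eqP ? /eqP ?]; exists x, y.
apply/implyP => fX; apply/forallP => g; apply/implyP => gX; apply/implyP => fg.
have [x [y [xy <- <-]]] := H f g fX gX fg.
by apply/existsP; exists (x, y); rewrite /= xy !eqxx.
Qed.

Definition even_cliques : {set {set 'I_n}} :=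
  [set X : {set 'I_n} | [&& X != set0, ~~ odd #|X| & dual_clique X]].

Definition within (X : {set 'I_n}) : rel G :=
  fun x y => (left_face P x y \in X) && (left_face P y x \in X).

Lemma withinC X : symmetric (within X).
Proof. by move=> x y; rewrite /within andbC. Qed.

(** Off the diagonal the clique condition gives the entries. On the diagonal they are forced, as the
    columns of both matrices sum to 0; for the right-hand side this uses that X is even. *)
Lemma lap_within (X : {set 'I_n}) : ~~ odd #|X| -> dual_clique X ->
  lap P (within X) = \matrix_(g, f) ((g \in X) && (f \in X)).
Proof.
move=> evX /dual_cliqueP clX; set M := \matrix_(g, f) _.
have off f g : g != f -> lap P (within X) g f = M g f.
  move=> gf; have fg : f != g by rewrite eq_sym.
  rewrite [RHS]mxE; case: (dual_adj_dec f g) => [[[x y] /= [xy <- <-]]|N].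
    by rewrite lap_edge // /within andbC.
  rewrite lap_nonadj //; case: (boolP (_ && _)) => // /andP[gX fX].
  by have [x [y [xy xyf yxg]]] := clX f g fX gX fg; case: (N x y).
apply/matrixP => g f; have [->|/off//] := eqVneq g f.
have M0 : \sum_h M h f = 0.
  rewrite (eq_bigr (fun h => (f \in X) * (h \in X))); last first.
    by move=> h _; rewrite mxE andbC.
  by rewrite -big_distrr /= sum_mem_bool (negbTE evX) mulr0.
have S0 := lap_col_sum (within X) f.
rewrite (bigD1 f) //= (eq_bigr (fun h => M h f)) in S0; last first.
  by move=> h hf; rewrite off.
by rewrite (bigD1 f) //= in M0; apply: (addIr _ (etrans S0 (esym M0))).
Qed.

Lemma rank_lap_within X : X \in even_cliques -> \rank (lap P (within X)) = 1%N.
Proof.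
rewrite inE => /and3P[/set0Pn[f fX] evX clX]; rewrite lap_within //.
set M := \matrix_(g, h) _; apply/eqP; rewrite eqn_leq lt0n mxrank_eq0.
apply/andP; split; last first.
  by apply/eqP => /matrixP/(_ f f); rewrite !mxE fX.
pose x : 'rV[bool]_n := \row_g (g \in X).
have -> : M = x^T *m x.
  by apply/matrixP => g h; rewrite !mxE big_ord_recl big_ord0 addr0 !mxE.
by rewrite (leq_trans (mxrankM_maxl _ _)) // rank_leq_col.
Qed.

(** The matrix is x x^T for a row x, whose support is X. Zero column sums make X even, and a nonzero
    entry off the diagonal requires a dual edge, so X is a clique. *)
Lemma lap_rank1 (a : rel G) : symmetric a -> \rank (lap P a) = 1%N ->
  exists2 X, X \in even_cliques & forall x y, adj x y -> a x y = within X x y.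
Proof.
move=> Sa; set L := lap P a => rk1.
have symL g f : L g f = L f g by apply: lap_sym.
have [g0 LE] := sym_rank1_bool symL rk1.
have L00 : L g0 g0.
  apply: contraT => /negbTE L00; suff L0 : L = 0 by rewrite L0 mxrank0 in rk1.
  by apply/matrixP => g f; rewrite LE symL LE L00 !andbF [RHS]mxE.
exists [set f | L g0 f]; last first.
  move=> x y xy; rewrite -(lap_edge a xy) -/L LE /within !inE andbC //.
rewrite inE; apply/and3P; split.
- by apply/set0Pn; exists g0; rewrite inE.
- rewrite -sum_mem_bool (eq_bigr (fun f => L f g0)) ?lap_col_sum // => f _.
  by rewrite inE symL.
apply/dual_cliqueP => f g; rewrite !inE => Lf Lg fg.
case: (dual_adj_dec f g) => [[[x y] /= xyP]|N]; first by exists x, y.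
by have := lap_nonadj a fg N; rewrite -/L LE Lf Lg.
Qed.

(** Each face of an even clique has a second face beside it, so it is an end of some dual edge of
    the clique and can be read off the edge set. *)
Lemma within_inj : {in even_cliques &, injective (fun X => edges_of (within X))}.
Proof.
suff sub X Y : X \in even_cliques -> edges_of (within X) = edges_of (within Y) ->
    X \subset Y.
  by move=> X Y XC YC E; apply/eqP; rewrite eqEsubset !sub.
rewrite inE => /and3P[_ evX /dual_cliqueP clX] E; apply/subsetP => f fX.
have [g /andP[gX gf]] : exists g, (g \in X) && (g != f).
  apply/existsP; apply: contraNT evX; rewrite negb_exists => /forallP N.
  rewrite (_ : X = [set f]) ?cards1 //; apply/setP => g; rewrite inE.
  have := N g; rewrite negb_and negbK; case: eqP => [->|_]; first by rewrite fX.
  by rewrite orbF => /negbTE.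
have [x [y [xy xyf yxg]]] := clX g f gX fX gf.
have: [set x; y] \in edges_of (within X).
  by rewrite mem_edges_of ?xy /within ?xyf ?yxg ?gX //; apply: withinC.
rewrite E mem_edges_of; last exact: withinC.
by rewrite /within yxg => /and3P[].
Qed.

Lemma card_rank1 :
  #|[set A : {set {set G}} | (A \subset edges G) &&
      (\rank (lap P (fun x y => [set x; y] \in A)) == 1%N)]| = #|even_cliques|.
Proof.
rewrite -(card_in_imset within_inj); congr #|pred_of_set _|.
apply/setP => A; rewrite inE; apply/andP/imsetP => [[AE /eqP rk1]|[X XC ->]].
  have [|X XC AX] := lap_rank1 _ rk1; first by move=> x y; rewrite setUC.
  by exists X; rewrite // -(edges_ofK AE); apply: eq_edges_of.
split; first exact: edges_of_sub.
rewrite (eq_lap (b := within X)) ?rank_lap_within // => x y xy.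
by rewrite mem_edges_of ?xy //; apply: withinC.
Qed.

End LaplacianRank.

(** * Euler genus and T-rotation systems *)

Section Genus.
Variables (G : sgraph) (n : nat) (P : cubic_map G n).

Lemma orientable_untwisted (R : rotation_data G) : pure_rotation_system R.1 ->
  (forall x y, adj x y -> plane_twisted P R x y = false) -> orientable R.
Proof.
move=> rotR ptw0.
apply/existsP; exists [set f : flag G | f.2 (+) flip P R f.1.1].
apply/forallP => -[[x y] s]; apply/implyP => /[!inE] xy.
have {xy} := ptw0 x y xy; rewrite (face_stepE P rotR) /= /plane_twisted.
by case: s; case: twisted; do 2!case: flip.
Qed.

(* An orientation makes the twists a coboundary, so every face of the plane   *)
(* map has an even number of twists on its boundary.                          *)
Lemma orientable_lap_diag (R : rotation_data G) f : pure_rotation_system R.1 ->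
  orientable R -> lap P (plane_twisted P R) f f = false.
Proof.
move=> rotR /existsP[O /forallP HO].
pose o x y := (x, y, false) \in O.
have O_flag x y s : adj x y -> ((x, y, s) \in O) = o x y (+) s.
  move=> xy; case: s; rewrite ?addbF ?addbT //.
  by have := HO (x, y, false); rewrite inE xy /= => /and3P[_ _ /eqP].
have O_rev x y : adj x y -> o y x = o x y (+) twisted R x y.
  move=> xy; have yx : adj y x by rewrite adj_sym.
  have := HO (x, y, false); rewrite inE xy => /and3P[_ /eqP + _].
  rewrite /= !O_flag // /=.
  by case: twisted; do 2!case: (o _ _).
have O_rot x y : adj y x -> o y (rot P y x) = o y x.
  move=> yx; have xy : adj x y by rewrite adj_sym.
  have := HO (x, y, flip P R y (+) twisted R x y); rewrite inE xy => /and3P[/eqP + _ _].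
  rewrite (face_stepE P rotR) addbK addbb /=.
  rewrite !O_flag ?adj_rot // (O_rev x y xy).
  by case: twisted; case: flip; do 2!case: (o _ _).
pose w y := o y (nb0 P y).
have ow x y : adj y x -> o y x = w y.
  have [r0 r1 _] := rotE P y.
  have [v0 v1] : adj y (nb0 P y) /\ adj y (nb1 P y) by rewrite !(adjE P) !eqxx !orbT.
  have := O_rot _ _ v0; have := O_rot _ _ v1; rewrite r0 r1 => o2 o1.
  by rewrite (adjE P) => /or3P[]/eqP->; rewrite ?o2 ?o1.
rewrite lap_diag -[RHS](sum_face_ends P (fun x => w x (+) flip P R x) f).
apply: eq_bigr => -[x y] /andP[/= xy _]; rewrite /plane_twisted.
have yx : adj y x by rewrite adj_sym.
have := O_rev x y xy; rewrite !ow //.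
by case: twisted; do 2!case: flip; do 2!case: (w _).
Qed.

Hypothesis planeP : plane_map P.
Variables (T : {set {set G}}).
Hypothesis spT : spanning_tree T.
Let connG := spanning_tree_connected spT.

Lemma euler_charE (R : rotation_data G) (r : G) : pure_rotation_system R.1 ->
  euler_char R = (2 - (\rank (lap P (plane_twisted P R)))%:Z)%R.
Proof.
move=> rotR; rewrite /euler_char (card_faces planeP connG rotR r).
have := euler_plane planeP; have := rank_leq_row (lap P (plane_twisted P R)); lia.
Qed.

Lemma genus0E (R : rotation_data G) (r : G) : pure_rotation_system R.1 ->
  embeds_in_genus 0 R = (edges_of (plane_twisted P R) == set0).
Proof.
move=> rotR; set A := edges_of _; have symA := plane_twistedC P R.
apply/embeds_in_genusP/eqP => [[S [gS]]|A0].
  have SE : S = Handles 0 \/ S = Crosscaps 0.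
    by case: S gS => [[|j]|c] //= gS; [left | right; rewrite gS].
  case: SE => -> /=; last by rewrite andbF.
  case/andP=> _ /eqP; rewrite (euler_charE r rotR) => rk0.
  have /eqP : \rank (lap P (plane_twisted P R)) = 0 by lia.
  rewrite mxrank_eq0 => /eqP L0; apply/eqP; rewrite -subset0.
  apply/subsetP => e eA.
  have [x [y [xy eE]]] := edges_set2 (subsetP (edges_of_sub _) _ eA).
  by move: eA; rewrite eE mem_edges_of // xy (lap_eq0 L0).
have ptw0 x y : adj x y -> plane_twisted P R x y = false.
  move=> xy; have := in_set0 [set x; y]; rewrite -A0 mem_edges_of // xy => /=.
  exact.
exists (Handles 0); split; rewrite //= orientable_untwisted // (euler_charE r rotR).
rewrite (_ : lap P _ = 0%R) ?mxrank0 //; apply/matrixP => g f; rewrite !mxE.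
by apply: big1 => -[x y] /andP[/= /ptw0 ->].
Qed.

(** In rank 1 the diagonal entry at any face of the clique is 1, whereas orientability makes the
    diagonal vanish; so the surface has one crosscap. *)
Lemma genus1E (R : rotation_data G) (r : G) : pure_rotation_system R.1 ->
  embeds_in_genus 1 R = (\rank (lap P (plane_twisted P R)) == 1).
Proof.
move=> rotR; set L := lap P _; have symA := plane_twistedC P R.
have chi1 : (euler_char R == 2 - 1%:Z)%R = (\rank L == 1).
  by rewrite (euler_charE r rotR) -/L (inj_eq (addrI _)) eqr_opp eqz_nat.
apply/embeds_in_genusP/idP => [[S [gS]]|rk1].
  case: S gS => [j|c] /=; first by move=> /(congr1 odd); rewrite mul2n odd_double.
  by move=> -> /and3P[_ _]; rewrite chi1.
exists (Crosscaps 1); split; rewrite //= chi1 rk1 andbT.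
apply/negP => /orientable_lap_diag-/(_ _ rotR) diag0.
have [X XC aX] := lap_rank1 symA (eqP rk1).
move: (XC); rewrite inE => /and3P[/set0Pn[f fX] evX clX].
by have := diag0 f; rewrite (eq_lap P aX) lap_within // mxE fX.
Qed.

Lemma flip_rotb (R : rotation_data G) b v : R.1 v = rotb P b v -> flip P R v = b.
Proof.
rewrite /flip => ->; case: b => /=; last by rewrite eqxx.
by rewrite eq_sym rot_neqV.
Qed.

(* Up to the orientation at one vertex, a T-rotation system is determined by  *)
(* the set of edges that it twists relative to the plane map.                 *)
Lemma card_T_rotation_systems (r : G) (Q : pred {set {set G}}) :
  #|[set R : rotation_data G |
      T_rotation_system T R && Q (edges_of (plane_twisted P R))]| =
  2 * #|[set A : {set {set G}} | (A \subset edges G) && Q A]|.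
Proof.
have [TE _ acT] := spT.
pose code (R : rotation_data G) := (flip P R r, edges_of (plane_twisted P R)).
rewrite -(card_in_imset (f := code)); last first.
  move=> R R'; rewrite !inE => /andP[+ _] /andP[+ _].
  case/andP=> /andP[rotR RE] RT /andP[/andP[rotR' RE'] RT'] [fr].
  move/eqP; rewrite edges_of_inj; try exact: plane_twistedC.
  move=> /'forall_forallP EA.
  have twE x y : adj x y -> plane_twisted P R x y = plane_twisted P R' x y.
    by move=> xy; apply/eqP; have /implyP := EA x y; apply.
  have fE x : flip P R x = flip P R' x.
    have twT (R1 : rotation_data G) x1 y1 :
        [disjoint R1.2 & T] -> [set x1; y1] \in T -> twisted R1 x1 y1 = false.
      by move=> /disjointFl; apply.
    (* On tree edges both systems are untwisted and agree in [plane_twisted], so the difference of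
       their flips is constant along T. *)
    pose s z := flip P R z (+) flip P R' z.
    have : s x = s r.
      apply: (spanning_tree_const spT) => u v Tuv.
      have uv : adj u v by rewrite -mem_edges (subsetP TE).
      have := twE u v uv; rewrite /plane_twisted (twT R) // (twT R') //=.
      by rewrite /s; do 4!case: (flip _ _ _).
    by rewrite /s fr addbb; do 2!case: (flip _ _ _).
  have eq1 : R.1 = R'.1.
    by apply/ffunP => v; rewrite (flipP P v rotR) (flipP P v rotR') fE.
  have eq2 : R.2 = R'.2.
    apply/setP => e; have [eE|NeE] := boolP (e \in edges G).
      have [x [y [xy ->]]] := edges_set2 eE.
      have := twE x y xy; rewrite /plane_twisted !fE.
      move=> /(congr1 (fun b => b (+) (flip P R' x (+) flip P R' y))).
      by rewrite !addbK.
    rewrite (contraNF (subsetP RE e) NeE).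
    by rewrite (contraNF (subsetP RE' e) NeE).
  case: R R' eq1 eq2 {fr EA twE fE rotR rotR' RE RE' RT RT'}.
  by move=> [? ?] [? ?] /= -> ->.
rewrite -card_bool -cardsT -cardsX; congr #|pred_of_set _|.
apply/setP => -[b A]; rewrite !inE /=; apply/imsetP/andP => [[R]|[AE QA]].
  by rewrite inE => /andP[_ QR] [_ ->]; rewrite edges_of_sub.
(* Flips that absorb the twists of A on T; adding a constant then adjusts the flip at r to b. *)
have [|s sT] := forest_coboundary (a := fun x y => [set x; y] \in A) TE acT.
  by move=> x y; rewrite setUC.
pose s' v := s v (+) s r (+) b.
pose R : rotation_data G := ([ffun v => rotb P (s' v) v],
  edges_of (fun x y => ([set x; y] \in A) (+) (s' x (+) s' y))).
have fR v : flip P R v = s' v by apply: flip_rotb; rewrite ffunE.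
have Csym : symmetric (fun x y => ([set x; y] \in A) (+) (s' x (+) s' y)).
  by move=> x y; rewrite setUC [s' x (+) _]addbC.
have twR x y : adj x y -> plane_twisted P R x y = ([set x; y] \in A).
  by move=> xy; rewrite /plane_twisted /twisted mem_edges_of // xy !fR /= addbK.
have AR : edges_of (plane_twisted P R) = A.
  by rewrite -[RHS](edges_ofK AE); apply: eq_edges_of.
exists R; last by rewrite /code AR fR /s' addbb.
rewrite inE AR QA andbT; apply/andP; split; last first.
  rewrite disjoint_subset; apply/subsetP => e eR; rewrite inE; apply/negP => eT.
  have [x [y [xy eE]]] := edges_set2 (subsetP TE _ eT).
  move: eR; rewrite eE mem_edges_of // => /andP[_]; rewrite sT -?eE // /s'.
  by do 2!rewrite [X in _ (+) X]addbACA addbb addbF; rewrite addbb.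
apply/andP; split; last exact: edges_of_sub.
by apply: (pure_rotationP (P := P) (s := s')) => v; rewrite ffunE.
Qed.

Lemma T_rotation_pure (R : rotation_data G) :
  T_rotation_system T R -> pure_rotation_system R.1.
Proof. by case/andP=> /andP[]. Qed.

Lemma num_embeddings0 (r : G) : num_embeddings T 0 = 2.
Proof.
transitivity
  (2 * #|[set A : {set {set G}} | (A \subset edges G) && (A == set0)]|).
  rewrite -(card_T_rotation_systems r); congr #|pred_of_set _|; apply/setP => R.
  rewrite !inE; case: (boolP (T_rotation_system T R)) => //= /T_rotation_pure rotR.
  exact: genus0E.
rewrite (_ : [set _ | _] = [set set0]) ?cards1 //; apply/setP => A; rewrite !inE.
by case: eqP => [->|_]; rewrite ?sub0set ?andbF.
Qed.

Lemma num_embeddings1 (r : G) : num_embeddings T 1 = 2 * #|even_cliques P|.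
Proof.
rewrite -card_rank1 -(card_T_rotation_systems r (fun A =>
  \rank (lap P (fun x y => [set x; y] \in A)) == 1)).
congr #|pred_of_set _|; apply/setP => R.
rewrite !inE; case: (boolP (T_rotation_system T R)) => //= /T_rotation_pure rotR.
rewrite genus1E //; congr (\rank _ == 1); apply: eq_lap => x y xy.
by rewrite mem_edges_of ?xy //; apply: plane_twistedC.
Qed.

End Genus.

(** * The plane embedding of a caterpillar-Halin graph *)

Section Caterpillar.
Variables (k : nat) (m : 'I_k -> nat).
Local Notation l := (num_legs m).
Local Notation V := (cat_vertex m).
Local Notation H := (caterpillar_halin m).
Local Notation oc := (outer_cycle m).

Definition up (j : nat) : bool :=
  if insub j is Some i then upper (m := m) i else false.

Lemma up_ord (j : 'I_l) : up j = upper j.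
Proof. by rewrite /up valK. Qed.

(* Faces are numbered so that 0 is the outer face, 1 and 2 lie above and      *)
(* below the edge v_0 v_1, and j + 3 is the face that begins at the leg with  *)
(* index j. [above i] and [below i] are the faces along v_i v_(i+1).          *)
Fixpoint above (i : nat) : nat :=
  if i is j.+1 then if up j then j.+3 else above j else 1.

Fixpoint below (i : nat) : nat :=
  if i is j.+1 then if up j then below j else j.+3 else 2.

(** One of the two faces along each path edge is the newest so far, numbered i + 2, and the other is
    older; most case distinctions below rest on this. *)
Lemma above_below i :
  above i = i.+2 /\ 0 < below i < i.+2 \/ below i = i.+2 /\ 0 < above i < i.+2.
Proof. by elim: i => [|i IHi] /=; [right | case: up; lia]. Qed.

(* The inner faces along the arcs of the outer cycle that leave and enter x;  *)
(* junk for the interior vertices of the path.                                *)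
Definition out_face (x : V) : nat :=
  match x with
  | inl i => if i == 0 :> nat then 1 else below l
  | inr j => if up j then j.+3 else below j
  end.

Definition in_face (x : V) : nat :=
  match x with
  | inl i => if i == 0 :> nat then 2 else above l
  | inr j => if up j then above j else j.+3
  end.

Lemma mem_outer (x : V) : (x \in oc) =
  match x with inl i => (i == 0 :> nat) || (i == l.+1 :> nat) | inr _ => true end.
Proof.
have Nl (i : 'I_l.+2) s : (inl i \in [seq (inr j : V) | j : 'I_l <- s]) = false.
  by apply/mapP=> -[].
rewrite /outer_cycle in_cons mem_cat in_cons.
case: x => [i|j]; first by rewrite !Nl orbF /=.
rewrite !(mem_map (f := inr)); [|by move=> ? ? []..].
by rewrite !mem_filter mem_rev -enumT mem_enum /= !andbT; case: upper.
Qed.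

Lemma size_outer : size oc = l.+2.
Proof.
rewrite /outer_cycle /= size_cat /= !size_map !size_filter count_rev.
rewrite addnS; congr _.+2; rewrite -[RHS]size_enum_ord.
exact: count_predC.
Qed.

Let face_rel : rel V := [rel x y | out_face x == in_face y].

(** The recursion of [above] follows the inner face under the upper part of the outer cycle as the
    legs are scanned from left to right. *)
Lemma upper_arc_path (s : seq 'I_l) i x :
  map val s = iota i (size s) -> out_face x = above i ->
  let p := [seq (inr j : V) | j <- s & upper j] in
  path face_rel x p /\ out_face (last x p) = above (i + size s).
Proof.
elim: s i x => [|j s IHs] i x /=; first by rewrite addn0.
case=> ji si xi; rewrite -up_ord ji; have := IHs i.+1; rewrite addSnnS /=.
case: ifP => upi IH /=; last by apply: IH; rewrite ?upi.
have [|-> ->] := IH (inr j) si; first by rewrite /= ji upi.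
by rewrite /face_rel /= ji upi xi eqxx.
Qed.

Lemma lower_arc_path (s : seq 'I_l) i x :
  map val s = iota i (size s) -> out_face x = below (i + size s) ->
  let p := [seq (inr j : V) | j <- rev s & ~~ upper j] in
  path face_rel x p /\ out_face (last x p) = below i.
Proof.
elim: s i x => [|j s IHs] i x /=; first by rewrite addn0.
case=> ji si xi; rewrite rev_cons filter_rcons -up_ord ji.
have [] := IHs i.+1 x si; first by rewrite addSnnS.
case: ifP => upi pP pL; last by split; rewrite // pL /= (negbFE upi).
rewrite map_rcons rcons_path last_rcons pP /face_rel /= pL ji /= (negbTE upi).
by rewrite eqxx.
Qed.

Lemma outer_face_cycle : path.cycle face_rel oc.
Proof.
have Eenum : map val (enum 'I_l) = iota 0 (size (enum 'I_l)).
  by rewrite val_enum_ord size_enum_ord.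
have [||pU lU] := @upper_arc_path (enum 'I_l) 0 (inl ord0); rewrite ?Eenum //=.
have [||pL lL] := @lower_arc_path (enum 'I_l) 0 (inl ord_max); rewrite ?Eenum //=.
  by rewrite size_enum_ord.
rewrite /= rcons_path cat_path last_cat /= pU pL /face_rel /= lL lU.
rewrite size_enum_ord add0n /=.
by rewrite !eqxx.
Qed.

Lemma out_face_prev x : x \in oc -> out_face (prev oc x) = in_face x.
Proof. by move=> /(prev_cycle outer_face_cycle) /eqP. Qed.

Lemma out_face_onto f : 0 < f < l.+3 -> exists2 x, x \in oc & out_face x = f.
Proof.
case: f => [|[|[|j]]] //= fl.
- by exists (inl ord0); rewrite ?mem_outer.
- have O0 : inl ord0 \in oc by rewrite mem_outer.
  by exists (prev oc (inl ord0)); rewrite ?mem_prev ?out_face_prev.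
have jl : j < l by lia.
have Oj : (inr (Ordinal jl) : V) \in oc by rewrite mem_outer.
case: (boolP (up j)) => upj.
  by exists (inr (Ordinal jl)) => //=; rewrite upj.
exists (prev oc (inr (Ordinal jl))); rewrite ?mem_prev ?out_face_prev //=.
by rewrite (negbTE upj).
Qed.

(** The outer cycle has l + 2 arcs and their inner faces exhaust the l + 2 inner faces, so none is
    repeated. *)
Lemma out_face_inj : {in oc &, injective out_face}.
Proof.
have U : uniq (map out_face oc).
  apply: (leq_size_uniq (iota_uniq 1 l.+2)).
    move=> f; rewrite mem_iota => /out_face_onto[x Ox <-].
    exact: map_f.
  by rewrite size_map size_outer size_iota.
move=> x y Ox Oy E.
rewrite -(nth_index x Ox) -(nth_index x Oy); congr nth.
apply/eqP; rewrite -(nth_uniq 0 _ _ U) ?size_map ?index_mem //.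
by rewrite !(nth_map x) ?index_mem // !nth_index // E.
Qed.

Lemma out_face_bound x : x \in oc -> 0 < out_face x < l.+3.
Proof.
rewrite mem_outer; case: x => [i|j] /=; last first.
  by have := above_below j; have := ltn_ord j; case: up; lia.
by have := above_below l; case: eqP; lia.
Qed.

(** Path vertices indexed by naturals; [inord] sends an index out of range to 0, whence the bounds
    in later lemmas. *)
Definition spine (i : nat) : V := inl (inord i).

Lemma eq_spine (w : V) i : i < l.+2 ->
  (w == spine i) = if w is inl j then j == i :> nat else false.
Proof. by case: w => //= j li; rewrite -[LHS]/(j == inord i) -val_eqE /= inordK. Qed.

Lemma eq_leg (w : V) (j : 'I_l) :
  (w == inr j) = if w is inr i then i == j :> nat else false.
Proof. by case: w. Qed.

Lemma spine_val (i : 'I_l.+2) : inl i = spine i.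
Proof. by rewrite /spine inord_val. Qed.

Lemma tree_arc_spine i : i <= l -> tree_arc (spine i) (spine i.+1).
Proof. by move=> li; rewrite /= !inordK //; lia. Qed.

Lemma tree_arc_leg (j : 'I_l) : tree_arc (spine j.+1) (inr j).
Proof. by rewrite /= inordK //; have := ltn_ord j; lia. Qed.

Lemma tree_arcP (x y : V) : tree_arc x y ->
  (exists2 i, i <= l & x = spine i /\ y = spine i.+1) \/
  (exists j : 'I_l, x = spine j.+1 /\ y = inr j).
Proof.
case: x y => [i|i] [j|j] //= /eqP ij; [left | right].
  exists (i : nat); first by have := ltn_ord j; lia.
  by rewrite !spine_val ij.
by exists j; rewrite spine_val ij.
Qed.

Lemma tree_arc_asym (x y : V) : tree_arc x y -> tree_arc y x = false.
Proof. by case: x y => [i|i] [j|j] //= /eqP; lia. Qed.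

Lemma mem_outer_spine i : i <= l.+1 -> (spine i \in oc) = (i == 0) || (i == l.+1).
Proof. by move=> li; rewrite mem_outer /= inordK. Qed.

Lemma outerP (x : V) : x \in oc ->
  [\/ x = spine 0, x = spine l.+1 | exists j : 'I_l, x = inr j].
Proof.
rewrite mem_outer; case: x => [i|j]; last by constructor 3; exists j.
by rewrite spine_val => /orP[]/eqP->; [constructor 1 | constructor 2].
Qed.

Lemma vertexP (x : V) : x \in oc \/ exists j : 'I_l, x = spine j.+1.
Proof.
rewrite mem_outer; case: x => [i|j]; last by left.
case: (boolP (_ || _)) => Hi; [by left | right].
have il : i.-1 < l by have := ltn_ord i; lia.
by exists (Ordinal il); rewrite spine_val /=; congr spine; lia.
Qed.

Lemma next_prev_outer x : x \in oc -> next oc (prev oc x) = x.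
Proof. by move=> Ox; apply: next_prev; apply: outer_cycle_uniq. Qed.

Lemma prev_next_outer x : x \in oc -> prev oc (next oc x) = x.
Proof. by move=> Ox; apply: prev_next; apply: outer_cycle_uniq. Qed.

Definition left_tree (x y : V) : nat :=
  match x, y with inl i, inl _ => above i | _, _ => in_face y end.

Definition right_tree (x y : V) : nat :=
  match x, y with inl i, inl _ => below i | _, _ => out_face y end.

(** The outer cycle runs clockwise, so the outer face 0 is to the left of its arcs and the inner
    face to the left of their reversals. Values at nonadjacent pairs are junk. *)
Definition leftn (x y : V) : nat :=
  if tree_arc x y then left_tree x y
  else if tree_arc y x then right_tree y x
  else if y == next oc x then 0 else out_face y.

Lemma leftn_spine i : i <= l ->
  leftn (spine i) (spine i.+1) = above i /\ leftn (spine i.+1) (spine i) = below i.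
Proof.
move=> li; have T := tree_arc_spine li.
by rewrite /leftn T (tree_arc_asym T) /= !inordK //; lia.
Qed.

Lemma leftn_leg (j : 'I_l) :
  leftn (spine j.+1) (inr j) = in_face (inr j : V) /\
  leftn (inr j) (spine j.+1) = out_face (inr j : V).
Proof.
have T := tree_arc_leg j.
by rewrite /leftn T (tree_arc_asym T).
Qed.

(** Each edge in one chosen direction, with the faces to its left and right. *)
Inductive dart : V -> V -> nat -> nat -> Prop :=
  | SpineDart i : i <= l -> dart (spine i) (spine i.+1) (above i) (below i)
  | LegDart (j : 'I_l) :
      dart (spine j.+1) (inr j) (in_face (inr j : V)) (out_face (inr j : V))
  | ArcDart x : x \in oc -> dart x (next oc x) 0 (out_face x).

Lemma leg_faces (j : 'I_l) :
  (out_face (inr j : V) = j.+3 /\ in_face (inr j : V) = above j /\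
    above j.+1 = j.+3 /\ below j.+1 = below j) \/
  (out_face (inr j : V) = below j /\ in_face (inr j : V) = j.+3 /\
    above j.+1 = above j /\ below j.+1 = j.+3).
Proof. by rewrite /=; case: (up j); [left | right]. Qed.

Lemma dart_faces x y p q : dart x y p q -> [/\ p < l.+3, q < l.+3 & p != q].
Proof.
case=> [i li|j|z /out_face_bound]; last by split; lia.
  by have := above_below i; split; lia.
by have := leg_faces j; have := above_below j; have := ltn_ord j; split; lia.
Qed.

(** Face 0 singles out the outer arcs. For a tree edge the larger face gives the index; the leg and
    the path edge that share it differ in their smaller face. *)
Lemma dart_uniq x y p q x' y' p' q' : dart x y p q -> dart x' y' p' q' ->
  p = p' /\ q = q' \/ p = q' /\ q = p' -> x = x' /\ y = y'.
Proof.
have leg_top (j : 'I_l) (fo := out_face (inr j : V)) (fi := in_face (inr j : V)) :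
    [/\ 0 < fo, 0 < fi, maxn fo fi = j.+3 &
        minn fo fi != minn (above j.+1) (below j.+1)].
  by rewrite /fo /fi; have := leg_faces j; have := above_below j; split; lia.
have spine_leg i (j : 'I_l) :
    above i = in_face (inr j : V) /\ below i = out_face (inr j : V) \/
    above i = out_face (inr j : V) /\ below i = in_face (inr j : V) -> False.
  move=> E; have [_ _ jmax jmin] := leg_top j; have ij : i = j.+1.
    by have := above_below i; lia.
  by rewrite ij in E; lia.
case=> [i li|j|z Oz]; case=> [i' li'|j'|z' Oz'] E.
- have -> // : i = i' by have := above_below i; have := above_below i'; lia.
- by case: (spine_leg i j'); lia.
- by have := above_below i; lia.
- by case: (spine_leg i' j); lia.
- have -> // : j = j'.
  apply: val_inj => /=.
  by have [_ _ + _] := leg_top j; have [_ _ + _] := leg_top j'; lia.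
- by have [] := leg_top j; lia.
- by have := above_below i'; lia.
- by have [] := leg_top j'; lia.
have /(out_face_inj Oz Oz') -> // : out_face z = out_face z'.
by have := out_face_bound Oz; have := out_face_bound Oz'; lia.
Qed.

Hypothesis l_gt0 : 0 < l.

Lemma tree_arc_outer (x y : V) : x \in oc -> y \in oc -> tree_arc x y = false.
Proof.
rewrite !mem_outer; case: x y => [i|i] [j|j] //=; first lia.
by have := ltn_ord j; lia.
Qed.

Lemma next_next x : x \in oc -> next oc (next oc x) != x.
Proof.
move=> Ox; have U := outer_cycle_uniq m; have S := size_outer.
case: (rot_to Ox) => i s def_s.
have Us : uniq (x :: s) by rewrite -def_s rot_uniq.
have : size (x :: s) = l.+2 by rewrite -def_s size_rot.
have N y := next_rot i U y; rewrite -!N def_s.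
case: s Us {def_s N} => [|y [|z s]] /= Us Ss;
  try by exfalso; move: Ss; clear -l_gt0; lia.
rewrite !eqxx; move: Us; rewrite !inE !negb_or => /andP[/and3P[xy xz _] _].
by rewrite [y == x]eq_sym (negbTE xy) eq_sym.
Qed.

Lemma leftn_arc x : x \in oc ->
  leftn x (next oc x) = 0 /\ leftn (next oc x) x = out_face x.
Proof.
move=> Ox; have Onx : next oc x \in oc by rewrite mem_next.
by rewrite /leftn !tree_arc_outer // eqxx eq_sym (negbTE (next_next Ox)).
Qed.

Lemma adj_dart (x y : H) : adj x y ->
  dart x y (leftn x y) (leftn y x) \/ dart y x (leftn y x) (leftn x y).
Proof.
have tree (u w : V) : tree_arc u w -> dart u w (leftn u w) (leftn w u).
  case/tree_arcP => [[i li [-> ->]]|[j [-> ->]]].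
    by have [-> ->] := leftn_spine li; constructor.
  by have [-> ->] := leftn_leg j; constructor.
have arc (u w : V) : cycle_arc u w -> dart u w (leftn u w) (leftn w u).
  case/andP=> Ou /eqP->; have [-> ->] := leftn_arc Ou; exact: ArcDart.
by case/or4P; [left | right | left | right]; auto.
Qed.

Lemma halin_adjE (x y : H) : adj x y =
  [|| tree_arc (m := m) x y, tree_arc (m := m) y x, cycle_arc (m := m) x y
    | cycle_arc (m := m) y x].
Proof. by []. Qed.

Lemma dart_adj x y p q : dart x y p q ->
  [/\ adj (x : H) y, leftn x y = p & leftn y x = q].
Proof.
case=> [i li|j|z Oz]; rewrite halin_adjE.
- by have [-> ->] := leftn_spine li; rewrite tree_arc_spine.
- by have [-> ->] := leftn_leg j; rewrite (tree_arc_leg j).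
- by have [-> ->] := leftn_arc Oz; rewrite /cycle_arc Oz eqxx !orbT.
Qed.

Definition tree_nb (x : V) : V :=
  match x with
  | inl i => if i == 0 :> nat then spine 1 else spine i.-1
  | inr j => spine j.+1
  end.

Definition spine_nb (b : bool) (x : V) : V :=
  if x isn't inl i then x else
  if (insub i.-1 : option 'I_l) is Some j
  then if up j == b then inr j else spine i.+1 else x.

(** With [tree_nb] first, the three neighbours are listed clockwise. *)
Definition cat_nb1 (x : V) : V := if x \in oc then prev oc x else spine_nb true x.
Definition cat_nb2 (x : V) : V := if x \in oc then next oc x else spine_nb false x.

Lemma inner_spine (j : 'I_l) : (spine j.+1 \in oc) = false.
Proof. by rewrite mem_outer_spine; have := ltn_ord j; lia. Qed.

Lemma tree_nb_inner (j : 'I_l) : tree_nb (spine j.+1) = spine j.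
Proof. by rewrite /= inordK //; have := ltn_ord j; lia. Qed.

Lemma cat_nb1_inner (j : 'I_l) :
  cat_nb1 (spine j.+1) = if up j then inr j else spine j.+2.
Proof.
rewrite /cat_nb1 inner_spine /= inordK; last by have := ltn_ord j; lia.
by rewrite valK eqb_id.
Qed.

Lemma cat_nb2_inner (j : 'I_l) :
  cat_nb2 (spine j.+1) = if up j then spine j.+2 else inr j.
Proof.
rewrite /cat_nb2 inner_spine /= inordK; last by have := ltn_ord j; lia.
by rewrite valK; case: up.
Qed.

Lemma leftn_tree_nb x : x \in oc ->
  leftn x (tree_nb x) = out_face x /\ leftn (tree_nb x) x = in_face x.
Proof.
case/outerP => [->|->|[j ->]] /=; last first.
- by have [-> ->] := leftn_leg j.
- by rewrite inordK //=; have [-> ->] := leftn_spine (leqnn l).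
by rewrite inordK //=; have [-> ->] := leftn_spine (leq0n l).
Qed.

Lemma tree_nb_outer x : x \in oc -> (tree_nb x \in oc) = false.
Proof.
case/outerP => [->|->|[j ->]] /=; last exact: inner_spine.
  by rewrite inordK // mem_outer_spine //; lia.
by rewrite inordK // mem_outer_spine //=; lia.
Qed.

Lemma adj_outer x w : x \in oc ->
  adj (x : H) w = [|| w == tree_nb x, w == prev oc x | w == next oc x].
Proof.
move=> Ox; rewrite halin_adjE /cycle_arc Ox andTb orbA.
have -> : tree_arc x w || tree_arc w x = (w == tree_nb x).
  case/outerP: Ox => [->|->|[j ->]] /=.
  - rewrite inordK // eq_spine //; case: w => //= i; rewrite ?inordK //; lia.
  - rewrite inordK // eq_spine //; case: w => //= i; rewrite ?inordK //; last first.
      by have := ltn_ord i; lia.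
    by have := ltn_ord i; lia.
  - rewrite eq_spine; last by have := ltn_ord j; lia.
    by case: w.
congr (_ || _); rewrite orbC; congr (_ || _).
apply/andP/eqP => [[Ow /eqP->]|->]; first by rewrite prev_next_outer.
by rewrite mem_prev next_prev_outer.
Qed.

Lemma adj_inner (j : 'I_l) w :
  adj (spine j.+1 : H) w = [|| w == spine j, w == inr j | w == spine j.+2].
Proof.
have jl := ltn_ord j.
rewrite halin_adjE /cycle_arc inner_spine andFb orFb (_ : _ && _ = false) ?orbF.
  rewrite !eq_spine ?eq_leg; try lia.
  by case: w => [i|i] /=; rewrite !inordK; lia.
apply/negP => /andP[Ow /eqP E]; have := inner_spine j.
by rewrite E mem_next Ow.
Qed.

Lemma cat_nbrsE (v : H) : nbrs v = [set tree_nb v; cat_nb1 v; cat_nb2 v].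
Proof.
apply/setP => w; rewrite !inE -orbA.
case: (vertexP v) => [Ov|[j ->]].
  by rewrite adj_outer // /cat_nb1 /cat_nb2 Ov.
rewrite adj_inner cat_nb1_inner cat_nb2_inner tree_nb_inner.
by case: up => //; rewrite [(w == inr j) || _]orbC.
Qed.

Lemma cat_nb_uniq (v : H) : uniq [:: tree_nb v; cat_nb1 v; cat_nb2 v].
Proof.
case: (vertexP v) => [Ov|[j ->]]; last first.
  rewrite cat_nb1_inner cat_nb2_inner tree_nb_inner.
  have jl := ltn_ord j; have N : (spine j == spine j.+2) = false.
    by rewrite eq_spine /= ?inordK; lia.
  by case: up; rewrite !cons_uniq !inE N.
rewrite /cat_nb1 /cat_nb2 Ov !cons_uniq !inE andbT negb_or.
have Op : prev oc v \in oc by rewrite mem_prev.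
have On : next oc v \in oc by rewrite mem_next.
have tree w : w \in oc -> tree_nb v != w.
  by apply: contraTneq => <-; rewrite tree_nb_outer.
rewrite !tree //=; have := next_next Op.
by rewrite next_prev_outer // eq_sym.
Qed.

Lemma leftn_rot (v : V) :
  [/\ leftn (tree_nb v) v = leftn v (cat_nb1 v),
      leftn (cat_nb1 v) v = leftn v (cat_nb2 v)
    & leftn (cat_nb2 v) v = leftn v (tree_nb v)].
Proof.
case: (vertexP v) => [Ov|[j ->]].
  have [-> ->] := leftn_tree_nb Ov; rewrite /cat_nb1 /cat_nb2 Ov.
  have Op : prev oc v \in oc by rewrite mem_prev.
  have := leftn_arc Op; rewrite next_prev_outer // => -[-> ->].
  by have [-> ->] := leftn_arc Ov; rewrite out_face_prev.
have jl := ltn_ord j.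
have [E5 E6] : leftn (spine j) (spine j.+1) = above j /\
    leftn (spine j.+1) (spine j) = below j.
  by apply: leftn_spine; lia.
have [E1 E2] := leftn_leg j; have [E3 E4] := leftn_spine jl.
rewrite cat_nb1_inner cat_nb2_inner tree_nb_inner E5 E6.
move: E1 E2 E3 E4; rewrite /=; case: (up j) => E1 E2 E3 E4;
  by rewrite ?E1 ?E2 ?E3 ?E4.
Qed.

Definition cat_left (x y : H) : 'I_l.+3 := inord (leftn x y).

Lemma val_cat_left (x y : H) : adj x y -> cat_left x y = leftn x y :> nat.
Proof. by move=> /(adj_dart)[]/dart_faces[lx ly _]; rewrite inordK. Qed.

Lemma cat_left_onto (f : 'I_l.+3) : exists x y, adj x y /\ cat_left x y = f.
Proof.
have arc (x : V) : x \in oc -> [/\ adj (x : H) (next oc x),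
    cat_left x (next oc x) = 0 :> nat & cat_left (next oc x) x = out_face x :> nat].
  move=> Ox; have [xy E1 E2] := dart_adj (ArcDart Ox).
  have yx : adj (next oc x : H) x by rewrite adj_sym.
  by rewrite !val_cat_left.
have [f0|f0] := posnP f.
  have [|xy E _] := arc (spine 0); first by rewrite mem_outer_spine.
  by exists (spine 0), (next oc (spine 0)); split=> //; apply: val_inj; rewrite /= E f0.
have [|x Ox xf] := @out_face_onto f; first by rewrite f0 /=.
have [xy _ E] := arc x Ox.
by exists (next oc x), x; split; [rewrite adj_sym | apply: val_inj; rewrite /= E].
Qed.

Lemma cat_left_neq (x y : H) : adj x y -> cat_left x y != cat_left y x.
Proof.
move=> xy; have yx : adj y x by rewrite adj_sym.
rewrite -val_eqE /= !val_cat_left //.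
by case: (adj_dart xy) => /dart_faces[]; rewrite // eq_sym.
Qed.

Lemma cat_dual_simple (x y x' y' : H) : adj x y -> adj x' y' ->
  cat_left x y = cat_left x' y' -> cat_left y x = cat_left y' x' ->
  (x, y) = (x', y').
Proof.
move=> xy xy' /(congr1 val) + /(congr1 val) /=.
have yx : adj y x by rewrite adj_sym.
have yx' : adj y' x' by rewrite adj_sym.
have := cat_left_neq xy'; rewrite -val_eqE /= !val_cat_left // => N E1 E2.
case: (adj_dart xy) => D; case: (adj_dart xy') => D'.
- by have [-> ->] := dart_uniq D D' (or_introl (conj E1 E2)).
- have [xy'E yx'E] := dart_uniq D D' (or_intror (conj E1 E2)).
  by rewrite -E1 xy'E yx'E eqxx in N.
- have [xy'E yx'E] := dart_uniq D D' (or_intror (conj E2 E1)).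
  by rewrite -E1 xy'E yx'E eqxx in N.
- by have [-> ->] := dart_uniq D D' (or_introl (conj E2 E1)).
Qed.

Lemma cat_left_rot (v : H) :
  [/\ cat_left (tree_nb v) v = cat_left v (cat_nb1 v),
      cat_left (cat_nb1 v) v = cat_left v (cat_nb2 v)
    & cat_left (cat_nb2 v) v = cat_left v (tree_nb v)].
Proof. by have [E1 E2 E3] := leftn_rot v; rewrite /cat_left E1 E2 E3. Qed.

Definition cat_map : cubic_map H l.+3 :=
  CubicMap (cat_nbrsE) (cat_nb_uniq)
    (fun v => let: And3 E _ _ := cat_left_rot v in E)
    (fun v => let: And3 _ E _ := cat_left_rot v in E)
    (fun v => let: And3 _ _ E := cat_left_rot v in E)
    cat_left_onto cat_left_neq cat_dual_simple.

(** * Planarity: cuts, cycles and the Euler formula for the caterpillar map *)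

Lemma halin_adjP (x y : H) : adj x y ->
  [\/ tree_arc (x : V) y, tree_arc (y : V) x, (x : V) \in oc /\ y = next oc x
    | (y : V) \in oc /\ x = next oc y].
Proof.
rewrite halin_adjE => /or4P[||/andP[? /eqP->]|/andP[? /eqP->]];
  by [constructor 1 | constructor 2 | constructor 3 | constructor 4].
Qed.

Lemma cat_left_arc (x : V) : x \in oc ->
  [/\ adj (x : H) (next oc x), cat_left x (next oc x) = 0 :> nat
    & cat_left (next oc x) x = out_face x :> nat].
Proof.
move=> Ox; have [xy E1 E2] := dart_adj (ArcDart Ox).
have yx : adj (next oc x : H) x by rewrite adj_sym.
by rewrite !val_cat_left.
Qed.

Fixpoint spine_potential (c : rel H) (i : nat) : bool :=
  if i is j.+1 then spine_potential c j (+) c (spine j) (spine i) else false.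

Definition tree_potential (c : rel H) (x : V) : bool :=
  match x with
  | inl i => spine_potential c i
  | inr j => spine_potential c j.+1 (+) c (spine j.+1) (inr j)
  end.

Lemma tree_potentialE (c : rel H) (x y : V) :
  tree_arc x y -> c x y = tree_potential c x (+) tree_potential c y.
Proof.
have psE i : i <= l.+1 -> tree_potential c (spine i) = spine_potential c i.
  by move=> li; rewrite /= inordK.
case/tree_arcP => [[i li [-> ->]]|[j [-> ->]]].
  by rewrite !psE //= ?addbA ?addbb //; lia.
have jl := ltn_ord j; rewrite psE //=; last lia.
by rewrite addbA addbb.
Qed.

(** Subtracting the cut of the tree potential leaves a function that vanishes on the tree. Every
    inner face has exactly one arc of the outer cycle, so its boundary sum forces the value 0 there
    too. *)
Lemma cat_face_perp (c : rel H) : symmetric c ->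
  (forall f, \sum_(p : H * H | adj p.1 p.2 && (left_face cat_map p.1 p.2 == f))
               c p.1 p.2 = 0)%R ->
  exists psi : H -> bool, forall x y, adj x y -> c x y = psi x (+) psi y.
Proof.
move=> Sc c0; exists (tree_potential c) => x y xy.
pose d u w := c u w (+) (tree_potential c u (+) tree_potential c w).
have Sd : symmetric d by move=> u w; rewrite /d Sc [tree_potential c u (+) _]addbC.
have d_tree u w : tree_arc (u : V) w -> d u w = false.
  by move=> uw; rewrite /d tree_potentialE // addbb.
have d0 f : (\sum_(p : H * H | adj p.1 p.2 && (left_face cat_map p.1 p.2 == f))
               d p.1 p.2 = 0)%R.
  rewrite [LHS]big_split /= c0 add0r; exact: (sum_face_ends cat_map).
have d_arc (z : V) : z \in oc -> d (next oc z) z = false.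
  move=> Oz; have [zn _ Ez] := cat_left_arc Oz.
  have nz : adj (next oc z : H) z by rewrite adj_sym.
  rewrite -[RHS](d0 (left_face cat_map (next oc z) z)).
  rewrite (bigD1 (next oc z, z)); last by apply/andP.
  rewrite big1; first exact/esym/addbF.
  case=> u w /andP[/andP[uw]].
  move=> /eqP/(congr1 val) /= Euw Nuw.
  case: (halin_adjP uw) => /= [/d_tree//|/d_tree|[Ou wE]|[Ow uE]].
  - by rewrite Sd.
  - have [_ E _] := cat_left_arc Ou; have := out_face_bound Oz.
    by rewrite -Ez -Euw wE E.
  have [_ _ E] := cat_left_arc Ow; case/eqP: Nuw; rewrite uE.
  suff -> : w = z by [].
  by apply: out_face_inj => //; rewrite -E -Ez -Euw uE.
have : d x y = false.
  case: (halin_adjP xy) => [/d_tree//|/d_tree|[Ox ->]|[Oy ->]]; rewrite ?d_arc //.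
    by rewrite Sd.
  by rewrite Sd d_arc.
by move/negbT; rewrite negb_add => /eqP.
Qed.

(** Give each inner face the value of c on its outer arc, and the outer face 0. The difference d
    vanishes on the outer cycle; the vertex condition then kills it on the legs and, from left to
    right, on the path. *)
Lemma cat_cycle_faces (c : rel H) : symmetric c ->
  (forall v, c v (nb0 cat_map v) (+) c v (nb1 cat_map v) (+) c v (nb2 cat_map v)
             = false) ->
  exists theta : 'I_l.+3 -> bool, forall x y, adj x y ->
    c x y = theta (left_face cat_map x y) (+) theta (left_face cat_map y x).
Proof.
move=> Sc c0.
pose theta (f : 'I_l.+3) :=
  [exists x : V, [&& x \in oc, out_face x == f & c x (next oc x)]].
exists theta => x y xy.
pose d u w :=
  c u w (+) (theta (left_face cat_map u w) (+) theta (left_face cat_map w u)).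
have Sd : symmetric d by move=> u w; rewrite /d Sc [theta _ (+) _]addbC.
have d_arc (z : V) : z \in oc -> d z (next oc z) = false.
  move=> Oz; have [_ E0 Ez] := cat_left_arc Oz.
  have -> : d z (next oc z) = c z (next oc z) (+) (false (+) c z (next oc z)).
    congr (_ (+) (_ (+) _)).
      apply/existsP => -[w /and3P[Ow /eqP + _]]; have := out_face_bound Ow.
      by rewrite /= E0 => /[swap] ->.
    apply/existsP/idP => [[w /and3P[Ow /eqP]]|cz].
      by rewrite /= Ez => /(out_face_inj Ow Oz) ->.
    by exists z; rewrite Oz /= Ez eqxx.
  by rewrite addFb addbb.
have d0 v : d v (nb0 cat_map v) (+) d v (nb1 cat_map v) (+) d v (nb2 cat_map v)
            = false.
  rewrite -[RHS](c0 v) /d (left_nb0 cat_map) (left_nb1 cat_map) (left_nb2 cat_map).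
  by do 3!case: (theta _); do 3!case: (c _ _).
have d_leg (z : V) : z \in oc -> d z (tree_nb z) = false.
  move=> Oz; rewrite -[RHS](d0 z) /= /cat_nb1 /cat_nb2 Oz d_arc // addbF.
  rewrite [d z (prev _ _)]Sd -[X in _ = _ (+) d _ X](next_prev_outer Oz).
  by rewrite d_arc ?addbF // mem_prev.
have d_spine i : i <= l -> d (spine i) (spine i.+1) = false.
  elim: i => [|j IHj] jl.
    have := @d_leg (spine 0); rewrite mem_outer_spine // => /(_ isT).
    by rewrite /= inordK.
  pose u := Ordinal jl.
  have leg : d (spine u.+1) (inr u) = false.
    by rewrite Sd; apply: d_leg; rewrite mem_outer.
  have : d (spine u.+1) (tree_nb (spine u.+1))
    (+) d (spine u.+1) (cat_nb1 (spine u.+1))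
    (+) d (spine u.+1) (cat_nb2 (spine u.+1)) = false := d0 _.
  rewrite cat_nb1_inner cat_nb2_inner tree_nb_inner [d _ (spine u)]Sd (IHj (ltnW jl)).
  by case: up; rewrite leg ?addbF.
have : d x y = false.
  have d_tree u w : tree_arc (u : V) w -> d u w = false.
    case/tree_arcP => [[i li [-> ->]]|[j [-> ->]]]; first exact: d_spine.
    by have := d_leg (inr j); rewrite mem_outer Sd; apply.
  case: (halin_adjP xy) => [/d_tree//|/d_tree|[Ox ->]|[Oy ->]]; rewrite ?d_arc //.
    by rewrite Sd.
  by rewrite Sd d_arc.
by move/negbT; rewrite negb_add => /eqP.
Qed.

Lemma cat_euler : #|H| + l.+3 = #|edges H| + 2.
Proof. by have := handshake cat_map; rewrite card_sum !card_ord; lia. Qed.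

Lemma cat_plane : plane_map cat_map.
Proof.
split; [exact: cat_face_perp | exact: cat_cycle_faces | exact: cat_euler].
Qed.

(** * Cliques of the dual graph *)

(** For f < g, adjacency in the dual: each inner face meets the outer face, and face j + 3 is
    attached to the two faces along v_j v_(j+1), as in a 2-tree. *)
Definition lower_face (g f : nat) : bool :=
  (f == 0) && (0 < g) ||
  match g with
  | 2 => f == 1
  | j.+3 => (f == above j) || (f == below j)
  | _ => false
  end.

Lemma dart_lower (x y : V) p q : dart x y p q -> lower_face (maxn p q) (minn p q).
Proof.
case=> [i li|j|z Oz].
- have := above_below i; case: i {li} => [|i] //=.
  by case: (up i) => ab; [rewrite (maxn_idPl _) ?(minn_idPr _)
    | rewrite (maxn_idPr _) ?(minn_idPl _)];
    rewrite /lower_face ?eqxx ?orbT //; lia.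
- have := above_below j; rewrite /=.
  by case: (up j) => ab; [rewrite (maxn_idPr _) ?(minn_idPl _)
    | rewrite (maxn_idPl _) ?(minn_idPr _)];
    rewrite /lower_face ?eqxx ?orbT //; lia.
by rewrite max0n min0n /lower_face eqxx; have := out_face_bound Oz; lia.
Qed.

Lemma lower_dart g f : f < g < l.+3 -> lower_face g f ->
  exists x y, adj (x : H) y /\
    (leftn x y = f /\ leftn y x = g \/ leftn x y = g /\ leftn y x = f).
Proof.
move=> fg; have dartE (x y : V) p q :
    dart x y p q -> (p = f /\ q = g \/ p = g /\ q = f) ->
    exists x y, adj (x : H) y /\
      (leftn x y = f /\ leftn y x = g \/ leftn x y = g /\ leftn y x = f).
  by move=> D E; have [xy Ep Eq] := dart_adj D; exists x, y; rewrite Ep Eq.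
rewrite /lower_face; case: eqP => [f0|_] /=.
  have [|x Ox xg] := @out_face_onto g; first lia.
  by move=> _; apply: (dartE _ _ _ _ (ArcDart Ox)); left; rewrite f0.
case: g fg {dartE}(dartE) => [|[|[|j]]] //= fg dartE.
  by move=> /eqP f1; apply: (dartE _ _ _ _ (SpineDart (leq0n l))); left; rewrite f1.
have jl : j < l by lia.
(* Face j + 3 meets its two older inner neighbours across leg j and across the path edge that
   follows it. *)
have := dartE _ _ _ _ (SpineDart jl); have := dartE _ _ _ _ (LegDart (Ordinal jl)).
rewrite /=; case: (up j) => leg sp /orP[]/eqP fE.
- by apply: leg; left.
- by apply: sp; right.
- by apply: sp; left.
- by apply: leg; right.
Qed.

Lemma cat_cliqueP (X : {set 'I_l.+3}) :
  reflect (forall f g, f \in X -> g \in X -> f < g -> lower_face g f)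
          (dual_clique cat_map X).
Proof.
apply: (iffP (dual_cliqueP cat_map X)) => clX f g fX gX fg.
  have [|x [y [xy xyf yxg]]] := clX f g fX gX; first by rewrite -val_eqE /=; lia.
  have yx : adj y x by rewrite adj_sym.
  have Ef : leftn x y = f by rewrite -val_cat_left // -xyf.
  have Eg : leftn y x = g by rewrite -val_cat_left // -yxg.
  by case: (adj_dart xy) => /dart_lower; rewrite Ef Eg;
    [rewrite (maxn_idPr _) ?(minn_idPl _)
    | rewrite (maxn_idPl _) ?(minn_idPr _)] => //; lia.
have build (f' g' : 'I_l.+3) : f' \in X -> g' \in X -> f' < g' ->
    exists x y, [/\ adj (x : H) y, left_face cat_map x y = f'
                  & left_face cat_map y x = g'].
  move=> fX' gX' fg'; have [|x [y [xy E]]] := lower_dart _ (clX _ _ fX' gX' fg').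
    by have := ltn_ord g'; lia.
  have yx : adj y x by rewrite adj_sym.
  by case: E => -[E1 E2]; [exists x, y | exists y, x]; split=> //;
     apply: val_inj; rewrite /= val_cat_left.
move: fg; rewrite -val_eqE neq_ltn => /orP[fg|gf]; first exact: build.
have [x [y [xy xg yf]]] := build _ _ gX fX gf.
by exists y, x; split; rewrite // adj_sym.
Qed.

Definition inner_lower (g : 'I_l.+3) : {set 'I_l.+3} := 
  [set f : 'I_l.+3 | (0 < f < g) && lower_face g f].

Lemma card_inner_lower g :
  #|inner_lower g| = match val g with 0 | 1 => 0 | 2 => 1 | _ => 2 end.
Proof.
have gl := ltn_ord g; rewrite /inner_lower /lower_face /=.
case: (nat_of_ord g) gl => [|[|[|j]]] gl.
- by apply: eq_card0 => f; rewrite !inE; lia.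
- by apply: eq_card0 => f; rewrite !inE; lia.
- have -> : [set f : 'I_l.+3 | (0 < f < 2) &&
      ((f == 0 :> nat) && (0 < 2) || (f == 1 :> nat))]
      = [set inord 1].
    by apply/setP => f; rewrite !inE -[RHS]val_eqE /= inordK //; lia.
  by rewrite cards1.
have := above_below j => ab.
have -> : [set f : 'I_l.+3 | (0 < f < j.+3) && ((f == 0 :> nat) && (0 < j.+3) ||
    ((f == above j :> nat) || (f == below j :> nat)))]
  = [set inord (above j); inord (below j)].
  apply/setP => f; rewrite !inE.
  rewrite -[f == inord (above j)]val_eqE -[f == inord (below j)]val_eqE.
  by rewrite /= !inordK; lia.
by rewrite cards2 -val_eqE /= !inordK; lia.
Qed.

(* An even clique is coded by its largest face g and its other inner faces:   *)
(* parity tells whether it contains the outer face.                           *)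
Definition clique_code : {set 'I_l.+3 * {set 'I_l.+3}} :=
  [set gZ : 'I_l.+3 * {set 'I_l.+3} |
    (gZ.1 != ord0) && (gZ.2 \subset inner_lower gZ.1)].

Definition clique_of (gZ : 'I_l.+3 * {set 'I_l.+3}) : {set 'I_l.+3} :=
  let Y := gZ.1 |: gZ.2 in if odd #|Y| then ord0 |: Y else Y.

Lemma card_clique_code : #|clique_code| = 4 * l + 3.
Proof.
rewrite -sum1_card (eq_bigl (fun gZ : 'I_l.+3 * {set 'I_l.+3} =>
  (gZ.1 != ord0) && (gZ.2 \in powerset (inner_lower gZ.1)))); last first.
  by move=> gZ; rewrite !inE.
rewrite -(pair_big_dep (fun g => g != ord0)
  (fun g Z => Z \in powerset (inner_lower g)) (fun _ _ => 1)) /=.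
under eq_bigr do rewrite sum1_card card_powerset card_inner_lower.
(* Face 1 contributes 1 set, face 2 contributes 2, and each of the other l inner faces 4. *)
rewrite big_mkcond /= !big_ord_recl /= (eq_bigr (fun _ => 4)) //.
by rewrite sum_nat_const card_ord; lia.
Qed.

Lemma mem_clique_of gZ f : gZ \in clique_code -> f != ord0 ->
  (f \in clique_of gZ) = (f == gZ.1) || (f \in gZ.2).
Proof.
by move=> _ f0; rewrite /clique_of; case: odd; rewrite !inE // (negbTE f0).
Qed.

Lemma clique_of_inj : {in clique_code &, injective clique_of}.
Proof.
move=> [g Z] [g' Z'] DZ DZ' E.
have := DZ; have := DZ'; rewrite !inE /=.
move=> /andP[g'0 /subsetP Zg'] /andP[g0 /subsetP Zg].
have memE f : f != ord0 -> (f == g) || (f \in Z) = (f == g') || (f \in Z').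
  by move=> f0; rewrite -(mem_clique_of DZ f0) E (mem_clique_of DZ').
have gg' : g = g'.
  have : (g == g') || (g \in Z') by rewrite -memE ?eqxx.
  case/orP=> [/eqP//|/Zg']; rewrite inE => /andP[/andP[_ lt1] _].
  have : (g' == g) || (g' \in Z) by rewrite memE ?eqxx.
  case/orP=> [/eqP//|/Zg]; rewrite inE => /andP[/andP[_ lt2] _].
  by lia.
rewrite -{}gg' in Zg' memE *; congr (_, _); apply/setP => f.
have [->|f0] := eqVneq f ord0.
  by apply/idP/idP => [/Zg|/Zg']; rewrite inE.
have := memE f f0; have [->|//] := eqVneq f g.
by move=> _; apply/idP/idP => [/Zg|/Zg']; rewrite inE ltnn andbF.
Qed.

Lemma clique_of_even gZ : gZ \in clique_code -> clique_of gZ \in even_cliques cat_map.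
Proof.
move=> DZ; have := DZ; case: gZ DZ => g Z DZ; rewrite !inE /= => /andP[g0 /subsetP Zg].
have gpos : 0 < g by rewrite lt0n; move: g0; rewrite -val_eqE.
have inZ f : f \in Z -> (0 < f < g) && lower_face g f by move/Zg; rewrite inE.
have Y0 : ord0 \notin g |: Z.
  by rewrite !inE negb_or eq_sym g0; apply/negP => /inZ.
apply/and3P; split.
- by apply/set0Pn; exists g; rewrite mem_clique_of //= eqxx.
- rewrite /clique_of /=; case: ifPn => // oddY.
  by rewrite cardsU1 Y0 /= oddY.
apply/cat_cliqueP => f f' fX fX' ff'.
have f'0 : f' != ord0 by rewrite -val_eqE /=; lia.
have [f0|f0] := eqVneq f ord0.
  by rewrite /lower_face f0 /= (leq_trans _ ff').
move: fX fX'; rewrite !mem_clique_of //= => fX fX'.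
case/orP: fX' => [/eqP f'g|/inZ /andP[f'lt f'low]]; last first.
  case/orP: fX => [/eqP fg|/inZ /andP[flt flow]]; first by rewrite fg in ff'; lia.
  have gl := ltn_ord g; move: f'low flow f'lt flt gl; rewrite /lower_face.
  case: (nat_of_ord g) => [|[|[|j]]]; try lia.
  move=> f'low flow f'lt flt gl.
  have jl : j <= l by lia.
  (* The two older inner neighbours of face j + 3 are adjacent across v_j v_(j+1). *)
  have := dart_lower (SpineDart jl); have ab := above_below j.
  have -> : maxn (above j) (below j) = f' by lia.
  by have -> : minn (above j) (below j) = f by lia.
case/orP: fX => [/eqP fg|/inZ /andP[flt flow]]; first by rewrite fg f'g ltnn in ff'.
by rewrite f'g.
Qed.

Lemma clique_of_onto X : X \in even_cliques cat_map ->
  exists2 gZ, gZ \in clique_code & X = clique_of gZ.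
Proof.
rewrite inE => /and3P[X0 evX /cat_cliqueP clX].
have [f /andP[fX f0]] : exists f, (f \in X) && (f != ord0).
  apply/existsP; apply: contraNT evX; rewrite negb_exists => /forallP N.
  rewrite (_ : X = [set ord0]) ?cards1 //; apply/eqP; rewrite eqEsubset sub1set.
  have X_sub : X \subset [set ord0].
    by apply/subsetP => f fX; have := N f; rewrite fX negbK inE.
  rewrite X_sub; have /set0Pn[f fX] := X0.
  by have /set1P <- := subsetP X_sub f fX.
pose g := [arg max_(i > f in X) (i : nat)].
have [gX gmax] : g \in X /\ forall i, i \in X -> i <= g.
  by rewrite /g; case: arg_maxnP.
have g0 : g != ord0.
  by have := gmax f fX; move: f0; rewrite -!val_eqE /=; lia.
have codeX : (g, X :\ ord0 :\ g) \in clique_code.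
  rewrite inE /= g0; apply/subsetP => h; rewrite !inE => /and3P[hg h0 hX].
  have lt_hg : h < g by have := gmax h hX; move: hg; rewrite -val_eqE /=; lia.
  by rewrite lt_hg clX // lt0n; move: h0; rewrite -val_eqE /= => ->.
exists (g, X :\ ord0 :\ g) => //.
have YE : g |: X :\ ord0 :\ g = X :\ ord0 by rewrite setD1K // !inE g0.
rewrite /clique_of /= YE; have := cardsD1 ord0 X.
case: (boolP (ord0 \in X)) => [X00|X00] E; move: evX; rewrite E.
  by rewrite add1n /= negbK => ->; rewrite setD1K.
rewrite add0n => /negbTE->; apply/setP => h; rewrite !inE.
by case: eqP => [->|//]; rewrite (negbTE X00).
Qed.

Lemma card_even_cliques : #|even_cliques cat_map| = 4 * l + 3.
Proof.
rewrite -card_clique_code -(card_in_imset clique_of_inj); congr #|pred_of_set _|.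
apply/setP => X; apply/idP/imsetP => [/clique_of_onto//|[gZ DZ ->]].
exact: clique_of_even.
Qed.

End Caterpillar.

(** * The number of legs and the final count *)

Lemma num_legsE (k : nat) (m : 'I_k -> nat) : 2 <= k ->
  num_legs m = \sum_(i < k) m i + (k - 2).
Proof.
case: k m => [|[|k]] m // _; rewrite /num_legs /block_size big_split /=; congr (_ + _).
rewrite big_ord_recl big_ord_recr /= ltnn addn0 add0n (eq_bigr (fun _ => 1)).
  by rewrite sum1_card card_ord; lia.
by move=> i _; rewrite /bump /= add1n ltnS ltn_ord.
Qed.

Theorem theorem3p6 (k : nat) (hk : 2 <= k) (m : 'I_k -> nat)
    (hm : forall i : 'I_k, 1 <= m i)
    (T : {set {set caterpillar_halin m}}) (hT : spanning_tree T) :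
  num_embeddings T 0 = 2 /\
  num_embeddings T 1 = 8 * (\sum_(i < k) m i + k) - 10.
Proof.
have lE := num_legsE m hk.
have sum_m : k <= \sum_(i < k) m i.
  by rewrite -{1}(card_ord k) -sum1_card; apply: leq_sum => i _; apply: hm.
have l_gt0 : 0 < num_legs m by lia.
have r : caterpillar_halin m := inl ord0.
split; first exact: (num_embeddings0 (cat_plane l_gt0) hT r).
by rewrite (num_embeddings1 (cat_plane l_gt0) hT r) card_even_cliques lE; lia.
Qed.
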